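(* Let $1\le k\le n$ be integers. If $d=(d_1,\ldots,d_n)\in\Delta_{n,k}$ is such that $$d_{i_1}+\cdots+d_{i_{n-k}}\ge 1\quad\text{for any pairwise distinct } i_1,\ldots,i_{n-k}\in\{1,\ldots,n\},$$ then $\mu^{-1}(d)$ is a connected subspace of ${\rm Gr}_k(\mathbb{R}^n)$.
   Context: ${\rm Gr}_k(\mathbb{R}^n)$ is the Grassmannian of all $k$-dimensional linear subspaces of $\mathbb{R}^n$ (with the Euclidean inner product). It is identified with a subspace of the space ${\rm Symm}_n(\mathbb{R})$ of real symmetric $n\times n$ matrices by sending $V$ to the matrix $\pi_V$, in the canonical basis, of the orthogonal projection of $\mathbb{R}^n$ onto $V$; thus ${\rm Gr}_k(\mathbb{R}^n)=\{P\in{\rm Symm}_n(\mathbb{R})\mid P^2=P,\ {\rm tr}(P)=k\}$. The map $\mu:{\rm Gr}_k(\mathbb{R}^n)\to\mathbb{R}^n$ (the Schur-Horn map) assigns to $V$ the vector of diagonal entries of $\pi_V$. The hypersimplex is $\Delta_{n,k}=\{x\in\mathbb{R}^n\mid 0\le x_i\le 1 \text{ for all } i,\ x_1+\cdots+x_n=k\}$; it is the image of $\mu$. *)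

(* Defs.v *)
From HB Require Import structures.
From mathcomp Require Import all_boot all_order all_algebra.
From mathcomp Require Import all_classical all_reals all_analysis.

Set Implicit Arguments.
Unset Strict Implicit.
Unset Printing Implicit Defensive.

Import Order.TTheory GRing.Theory Num.Theory.
Import numFieldNormedType.Exports.

Local Open Scope classical_set_scope.
Local Open Scope ring_scope.

(* A subspace V is represented by the matrix of its orthogonal projection; see
   [grassmannianP] and [is_orthproj_exists]. The topology is induced from 'M[R]_n. *)
Definition grassmannian (R : realType) (n k : nat) : set 'M[R]_n :=
  [set P | [/\ P^T = P, P *m P = P & \tr P = k%:R]].
Arguments grassmannian : clear implicits.

Definition schur_horn (R : realType) (n : nat) (P : 'M[R]_n) : 'rV[R]_n :=
  \row_i P i i.

Definition hypersimplex (R : realType) (n k : nat) : set 'rV[R]_n :=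
  [set x | (forall i, 0 <= x 0 i <= 1) /\ \sum_i x 0 i = k%:R].
Arguments hypersimplex : clear implicits.

(* The fibre of the restriction of [schur_horn] to Gr_k(R^n). *)
Definition schur_horn_fibre (R : realType) (n k : nat) (d : 'rV[R]_n)
  : set 'M[R]_n :=
  grassmannian R n k `&` @schur_horn R n @^-1` [set d].

(* P is the orthogonal projection onto the row space of V; it acts on row
   vectors from the right, which makes no difference since it is symmetric. *)
Definition is_orthproj (R : realType) (n : nat) (V P : 'M[R]_n) : Prop :=
  forall u : 'rV[R]_n, (u *m P <= V)%MS /\
    forall v : 'rV[R]_n, (v <= V)%MS -> (u - u *m P) *m v^T = 0.

Lemma mulmx_tr_eq0 (R : realType) (m n : nat) (A : 'M[R]_(m, n)) :
  A *m A^T = 0 -> A = 0.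
Proof.
move=> A0; apply/matrixP => i j; rewrite mxE.
have /eqP : (A *m A^T) i i = 0 by rewrite A0 mxE.
rewrite mxE psumr_eq0; last by move=> l _; rewrite mxE -expr2 sqr_ge0.
by move=> /allP/(_ j (mem_index_enum j)); rewrite mxE mulf_eq0 orbb => /eqP.
Qed.

Lemma mxtrace_idem (F : fieldType) (n : nat) (P : 'M[F]_n) :
  P *m P = P -> \tr P = (\rank P)%:R.
Proof.
move=> PP.
suff E : row_base P *m col_base P = 1%:M.
  by rewrite -{1}(mulmx_base P) mxtrace_mulC E mxtrace1.
apply: (row_free_inj (row_base_free P)).
apply: (row_full_inj (col_base_full P)).
by rewrite mul1mx -mulmxA mulmx_base mulmxA mulmx_base.
Qed.

Lemma is_orthprojP (R : realType) (n : nat) (V P : 'M[R]_n) :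
  is_orthproj V P <-> [/\ P^T = P, P *m P = P & (P :=: V)%MS].
Proof.
split=> [VP|[Ps PP PV] u]; last first.
  split; first by rewrite -PV submxMl.
  move=> v; rewrite -PV => /submxP[w ->].
  by rewrite trmx_mul Ps mulmxA mulmxBl -mulmxA PP subrr mul0mx.
have PleV : (P <= V)%MS.
  by apply/row_subP => i; rewrite rowE; case: (VP (delta_mx 0 i)).
have ort : (1%:M - P) *m V^T = 0.
  apply/trmx_inj/row_matrixP => i; rewrite trmx_mul trmxK row_mul trmx0 row0.
  apply/trmx_inj; rewrite trmx_mul trmxK trmx0.
  apply/row_matrixP => j; rewrite row_mul row0 rowE mulmxBr mulmx1.
  by case: (VP (delta_mx 0 j)) => _; apply; apply: row_sub.
have [D PE] := submxP PleV.
have PT : P *m P^T = P^T.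
  apply/esym/eqP; rewrite -subr_eq0 -{1}(mul1mx P^T) -mulmxBl PE.
  by rewrite [in X in _ *m X]trmx_mul mulmxA -PE ort mul0mx.
have Ps : P^T = P by rewrite -{2}[P]trmxK -{2}PT trmx_mul trmxK.
have VV : V *m P = V.
  apply/trmx_inj; rewrite trmx_mul Ps; apply/esym/eqP.
  by rewrite -subr_eq0 -{1}(mul1mx V^T) -mulmxBl ort.
split=> //; first by move: PT; rewrite Ps.
by apply/eqmxP; rewrite PleV -{1}VV submxMl.
Qed.

Lemma grassmannianP (R : realType) (n k : nat) (P : 'M[R]_n) :
  grassmannian R n k P <->
  exists2 V : 'M[R]_n, \rank V = k & is_orthproj V P.
Proof.
split=> [[Ps PP trP]|[V rV /is_orthprojP[Ps PP PV]]]; last first.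
  by split=> //; rewrite (mxtrace_idem PP) PV rV.
exists P; last exact/is_orthprojP.
by apply/eqP; rewrite -(eqr_nat R) -trP (mxtrace_idem PP).
Qed.

Lemma is_orthproj_exists (R : realType) (n : nat) (V : 'M[R]_n) :
  exists P, is_orthproj V P.
Proof.
have [Bf BV] := (row_base_free V, eq_row_base V).
move: (row_base V) Bf BV => B Bf BV.
have BBu : B *m B^T \in unitmx.
  rewrite -row_free_unit -kermx_eq0; apply/eqP.
  set K := kermx _; have KB : K *m (B *m B^T) = 0 by exact: mulmx_ker.
  apply: (row_free_inj Bf); rewrite mul0mx.
  by apply: mulmx_tr_eq0; rewrite trmx_mul mulmxA -(mulmxA K) KB mul0mx.
have BBT : (B *m B^T)^T = B *m B^T by rewrite trmx_mul trmxK.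
pose P := B^T *m invmx (B *m B^T) *m B.
have BP : B *m P = B by rewrite /P !mulmxA mulmxV// mul1mx.
exists P; apply/is_orthprojP; split.
- by rewrite /P !trmx_mul trmxK trmx_inv BBT mulmxA.
- by rewrite -[LHS]mulmxA BP.
- apply: eqmx_trans BV; apply/eqmxP.
  by rewrite submxMl -{1}BP submxMl.
Qed.

(* Main.v *)
(* A point of the Grassmannian is the row space of a k x n matrix F, with squared
   maximal minors m_f(F), where f runs over the maps from k to n. For e > 0 let
   x_e(F) minimize the strictly convex (in the log scale) potential
     x |-> sum_f m_f(F) exp (sum_j x_(f j) - <d, x> + e/2 |x|^2)
   and let P_e(F) be the projection onto the row space of F with columns scaled
   by exp(x_e(F) / 2). By Cauchy-Binet, the minimum is critical exactly when
   the diagonal of P_e(F) is d - e x_e(F). If F is semistable, e |x_e(F)|^2 is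
   bounded, hence this diagonal tends to d as e tends to 0; if the row space of F
   is already in the fibre, x_e(F) = 0. Therefore a path of semistable matrices
   between two points of the fibre is carried by P_e to paths between these
   points whose image under the Schur-Horn map is arbitrarily close to d, and
   compactness of the Grassmannian forces the fibre to be connected.
   The hypothesis on d makes F semistable unless two minors differing by one
   exchange vanish together, a condition of codimension 2. So semistable paths
   exist: perturb F to make all its maximal minors nonzero, then move
   one column at a time, the new column avoiding finitely many hyperplanes. *)
Require Import Defs.
From HB Require Import structures.
From mathcomp Require Import all_boot all_order all_algebra.
From mathcomp Require Import all_fingroup.
From mathcomp Require Import all_classical all_reals all_analysis.
From mathcomp Require Import polyrcf zify ring lra.
Import Order.TTheory GRing.Theory Num.Theory.
Import numFieldNormedType.Exports.
Local Open Scope classical_set_scope.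
Local Open Scope ring_scope.

Set Implicit Arguments.
Unset Strict Implicit.
Unset Printing Implicit Defensive.

(** * Minors and the Cauchy-Binet formula *)

Lemma det_mulmx_ffun (R : comNzRingType) k n (A : 'M[R]_(k, n)) (B : 'M[R]_(n, k)) :
  \det (A *m B) =
  \sum_(f : {ffun 'I_k -> 'I_n}) (\prod_i A i (f i)) * \det (rowsub f B).
Proof.
rewrite /determinant.
transitivity (\sum_(f : {ffun 'I_k -> 'I_n}) \sum_(s : 'S_k)
    (-1) ^+ s * \prod_i (A i (f i) * B (f i) (s i))).
  rewrite exchange_big; apply: eq_bigr => /= s _; rewrite -big_distrr /=.
  congr (_ * _); rewrite -(bigA_distr_bigA (fun i j => A i j * B j (s i))) /=.
  by apply: eq_bigr => i _; rewrite mxE.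
apply: eq_bigr => f _; rewrite big_distrr; apply: eq_bigr => s _ /=.
rewrite big_split mulrCA; congr (_ * (_ * _)).
by apply: eq_bigr => i _; rewrite mxE.
Qed.

(** Summing over maps instead of subsets counts each subset k! times. Once the first determinant is
    expanded over permutations [s], replacing [f] by [f \o s] turns each of the k! terms into
    [\det (A *m B)]. *)
Lemma cauchy_binet (R : comNzRingType) k n (A : 'M[R]_(k, n)) (B : 'M[R]_(n, k)) :
  k`!%:R * \det (A *m B) =
  \sum_(f : {ffun 'I_k -> 'I_n}) \det (colsub f A) * \det (rowsub f B).
Proof.
under eq_bigr do rewrite /(\det (colsub _ _)) big_distrl/=.
rewrite exchange_big /=.
under eq_bigr => s _.
  rewrite (_ : \sum_i _ = \det (A *m B)).
    over.
  rewrite det_mulmx_ffun [RHS](reindex (fun f : {ffun 'I_k -> 'I_n} => [ffun i => f (s i)])).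
    apply: eq_bigr => f _.
    have -> : rowsub [ffun i => f (s i)] B = row_perm s (rowsub f B).
      by apply/matrixP => i j; rewrite !mxE ffunE.
    rewrite row_permE det_mulmx det_perm [RHS]mulrCA -mulrA.
    congr (_ * (_ * _)); apply: eq_bigr => i _.
    by rewrite mxE ffunE.
  exists (fun f : {ffun 'I_k -> 'I_n} => [ffun i => f ((s^-1)%g i)]) => f _;
    by apply/ffunP => i; rewrite !ffunE ?permK ?permKV.
by rewrite sumr_const card_Sn mulr_natl.
Qed.

Definition minor (R : comNzRingType) k n (F : 'M[R]_(k, n)) (f : {ffun 'I_k -> 'I_n}) : R :=
  \det (colsub f F).

(** For injective [f], the indicator function of its image. *)
Definition hits k n (f : 'I_k -> 'I_n) (i : 'I_n) : nat := \sum_j (f j == i).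

Lemma minor_noninj (R : comNzRingType) k n (F : 'M[R]_(k, n)) (f : {ffun 'I_k -> 'I_n}) :
  ~~ injectiveb f -> minor F f = 0.
Proof.
move=> /injectivePn[i [j ij fij]]; rewrite /minor -det_tr.
by apply: (determinant_alternate ij) => l; rewrite !mxE fij.
Qed.

Lemma cauchy_binet_diag (R : comNzRingType) k n (F : 'M[R]_(k, n)) (D : 'rV[R]_n) :
  k`!%:R * \det (F *m diag_mx D *m F^T) =
  \sum_f minor F f ^+ 2 * \prod_i D 0 (f i).
Proof.
rewrite cauchy_binet; apply: eq_bigr => f _.
have -> : rowsub f F^T = (colsub f F)^T by apply/matrixP => i j; rewrite !mxE.
have -> : colsub f (F *m diag_mx D) = colsub f F *m diag_mx (\row_i D 0 (f i)).
  by apply/matrixP => i j; rewrite !mul_mx_diag !mxE.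
rewrite det_tr det_mulmx det_diag /minor mulrAC expr2; congr (_ * _).
by apply: eq_bigr => i _; rewrite mxE.
Qed.

(** Unitriangular block factors move the update into a 1 by 1 block. *)
Lemma det_rank1_update (R : comNzRingType) k (u : 'cV[R]_k) (v : 'rV[R]_k) :
  \det (1%:M + u *m v) = 1 + (v *m u) 0 0.
Proof.
pose L := block_mx (1%:M : 'M[R]_k) 0 v (1%:M : 'M[R]_1).
pose U := block_mx (1%:M + u *m v) u 0 (1%:M : 'M[R]_1).
pose L' := block_mx (1%:M : 'M[R]_k) 0 (- v) (1%:M : 'M[R]_1).
have E : L *m U *m L' = block_mx 1%:M u 0 (1%:M + v *m u).
  rewrite /L /U /L' !mulmx_block !(mul1mx, mulmx1, mul0mx, mulmx0, addr0, add0r).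
  have -> : 1%:M + u *m v + u *m - v = 1%:M by rewrite mulmxN addrK.
  rewrite mulmxDr mulmx1 mulmxN mulmxDl mul1mx mulmxA [v + _]addrC subrr.
  by rewrite [v *m u + _]addrC.
have := congr1 determinant E.
rewrite !det_mulmx !det_lblock !det_ublock !det1 !mulr1 !mul1r => ->.
by rewrite det_mx11 !mxE eqxx.
Qed.

(* The orthogonal projection onto the row space of [F]; junk unless [F] has full
   row rank. *)
Definition rowproj (R : comUnitRingType) k n (F : 'M[R]_(k, n)) : 'M[R]_n :=
  F^T *m invmx (F *m F^T) *m F.

Lemma gram_det (R : comNzRingType) k n (F : 'M[R]_(k, n)) :
  k`!%:R * \det (F *m F^T) = \sum_f minor F f ^+ 2.
Proof.
have := cauchy_binet_diag F (const_mx 1); rewrite diag_const_mx mulmx1 => ->.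
by apply: eq_bigr => f _; rewrite big1 ?mulr1 // => i _; rewrite mxE.
Qed.

(** Doubling the weight of column [i] multiplies the Gram determinant by [1 + rowproj F i i], by the
    rank one update, and the Cauchy-Binet term of each injective [f] by [1 + hits f i]. Comparing
    the two gives the claim. *)
Lemma rowproj_diag (R : comUnitRingType) k n (F : 'M[R]_(k, n)) (i : 'I_n) :
  F *m F^T \in unitmx ->
  rowproj F i i * \sum_f minor F f ^+ 2 = \sum_f minor F f ^+ 2 * (hits f i)%:R.
Proof.
move=> Mu; set M := F *m F^T in Mu *.
have := cauchy_binet_diag F (const_mx 1 + delta_mx 0 i).
rewrite linearD/= diag_const_mx mulmxDr mulmx1 mulmxDl.
have -> : F *m diag_mx (delta_mx 0 i) *m F^T = col i F *m (col i F)^T.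
  rewrite mul_mx_diag; apply/matrixP => a b; rewrite !mxE (bigD1 i)//= big1 ?addr0.
    by rewrite big_ord1 !mxE !eqxx mulr1.
  by move=> j ji; rewrite !mxE (negbTE ji) andbF mulr0 mul0r.
have -> : F *m F^T + col i F *m (col i F)^T =
    M *m (1%:M + invmx M *m col i F *m (col i F)^T).
  by rewrite mulmxDr mulmx1 !mulmxA mulmxV // mul1mx.
rewrite det_mulmx det_rank1_update mulrA gram_det.
have -> : ((col i F)^T *m (invmx M *m col i F)) 0 0 = rowproj F i i.
  rewrite /rowproj -!mulmxA -/M [in RHS]mxE [in LHS]mxE; apply: eq_bigr => a _.
  by rewrite !mxE; congr (_ * _); apply: eq_bigr => b _; rewrite !mxE.
rewrite mulrDr mulr1 mulrC.
have -> : \sum_f minor F f ^+ 2 * \prod_j (const_mx 1 + delta_mx 0 i : 'rV[R]_n) 0 (f j) =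
    \sum_f minor F f ^+ 2 + \sum_f minor F f ^+ 2 * (hits f i)%:R.
  rewrite -big_split /=; apply: eq_bigr => f _.
  have [fi|/minor_noninj->] := boolP (injectiveb f); last first.
    by rewrite expr0n !mul0r addr0.
  rewrite -{2}[minor F f ^+ 2]mulr1 -mulrDr; congr (_ * _); rewrite /hits.
  under eq_bigr do rewrite !mxE eqxx/=.
  have [[j fj]|nf] := pselect (exists j, f j = i).
    have ne l : l != j -> (f l == i) = false.
      by move=> lj; rewrite -fj (inj_eq (injectiveP _ fi)); exact/negbTE.
    rewrite (bigD1 j)//= (bigD1 (P := xpredT) (F := fun l => (f l == i) : nat) j)//=.
    rewrite fj eqxx !big1 ?mulr1 ?addn0 // => l /ne -> //.
    by rewrite addr0.
  have ne l : (f l == i) = false by apply/eqP => fl; apply: nf; exists l.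
  rewrite !big1 ?addr0 // => l _; by rewrite ne // addr0.
by move/addrI.
Qed.

(** * The potential, its convexity and its critical points *)

Lemma is_derive_sumT (R : numFieldType) (V W : normedModType R) (I : finType)
    (h : I -> V -> W) (x v : V) (dh : I -> W) :
  (forall i, is_derive x v (h i) (dh i)) ->
  is_derive x v (fun t => \sum_i h i t) (\sum_i dh i).
Proof.
move=> hd; rewrite (_ : (fun t => _) = \sum_i h i); last first.
  by apply/funext => t; rewrite fct_sumE.
elim/big_ind2 : _ => // [|f a g b fa gb]; [exact: is_derive_cst|exact: is_deriveD].
Qed.

Section Potential.
Context {R : realType} {k n : nat}.
Implicit Types (F : 'M[R]_(k, n)) (d x y : 'rV[R]_n) (e : R) (f : {ffun 'I_k -> 'I_n}).

Definition dotv x y : R := \sum_i x 0 i * y 0 i.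

Definition sumon f x : R := \sum_j x 0 (f j).

Definition expo d e f x : R := sumon f x - dotv d x + e / 2 * dotv x x.

Definition potential d e F x : R := \sum_f minor F f ^+ 2 * expR (expo d e f x).

(* For [c = 0] this is the Hilbert-Mumford criterion for semistability of [F]
   under rescaling of its columns, linearized by [d]; [c > 0] makes it uniform. *)
Definition semistable_above d (c : R) F :=
  forall x, exists2 f, c < minor F f ^+ 2 & dotv d x <= sumon f x.

Definition minimizes d e F x := forall y, potential d e F x <= potential d e F y.

Definition rescale F x : 'M[R]_(k, n) := F *m diag_mx (\row_i expR (x 0 i / 2)).

Lemma dotvv_ge0 x : 0 <= dotv x x.
Proof. by apply: sumr_ge0 => i _; rewrite -expr2 sqr_ge0. Qed.

Lemma sumon_hits f x : sumon f x = \sum_i x 0 i * (hits f i)%:R.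
Proof.
rewrite /hits; under [RHS]eq_bigr do rewrite natr_sum mulr_sumr.
rewrite exchange_big/=; apply: eq_bigr => j _.
rewrite (bigD1 (f j))//= eqxx mulr1 big1 ?addr0// => i ij.
by rewrite eq_sym (negbTE ij) mulr0.
Qed.

(** Coercivity: the one term given by semistability suffices, since its exponent is at least the
    quadratic part and [expR t >= 1 + t]. *)
Lemma potential_ge d e F x c : 0 <= c -> 0 <= e -> semistable_above d c F ->
  c * (1 + e / 2 * dotv x x) <= potential d e F x.
Proof.
move=> c0 e0 /(_ x)[f cf df]; rewrite /potential (bigD1 f)//=.
apply: ler_wpDr.
  by apply: sumr_ge0 => g _; rewrite mulr_ge0 ?sqr_ge0 ?expR_ge0.
apply: ler_pM => //; first by rewrite addr_ge0// mulr_ge0 ?divr_ge0 ?dotvv_ge0.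
  exact: ltW.
apply: le_trans (expR_ge1Dx _); rewrite lerD2l /expo lerDr; lra.
Qed.

Lemma potential0 d e F : potential d e F 0 = \sum_f minor F f ^+ 2.
Proof.
apply: eq_bigr => f _; rewrite /expo /sumon /dotv !big1 ?subr0 ?mulr0 ?addr0 ?expR0 ?mulr1//.
- by move=> i _; rewrite !mxE mulr0.
- by move=> i _; rewrite !mxE mulr0.
- by move=> i _; rewrite mxE.
Qed.

(** Strong convexity: the parallelogram identity yields the exponential factor, and the
    arithmetic-geometric mean inequality bounds each term. *)
Lemma potential_midpoint d e F x y :
  potential d e F (2^-1 *: (x + y)) * expR (e / 8 * dotv (x - y) (x - y)) <=
  (potential d e F x + potential d e F y) / 2.
Proof.
rewrite /potential mulr_suml -big_split/= mulr_suml; apply: ler_sum => f _.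
rewrite -[leLHS]mulrA -mulrDr -[leRHS]mulrA -expRD. rewrite ler_wpM2l ?sqr_ge0//.
have -> : expo d e f (2^-1 *: (x + y)) + e / 8 * dotv (x - y) (x - y) =
    expo d e f x / 2 + expo d e f y / 2.
  have q : dotv (2^-1 *: (x + y)) (2^-1 *: (x + y)) + dotv (x - y) (x - y) / 4 =
      (dotv x x + dotv y y) / 2.
    rewrite /dotv -big_split/= !mulr_suml -big_split/=; apply: eq_bigr => i _.
    by rewrite !mxE; field.
  have l : sumon f (2^-1 *: (x + y)) = (sumon f x + sumon f y) / 2.
    rewrite /sumon -big_split/= mulr_suml; apply: eq_bigr => i _.
    by rewrite !mxE mulrC.
  have l' : dotv d (2^-1 *: (x + y)) = (dotv d x + dotv d y) / 2.
    rewrite /dotv -big_split/= mulr_suml; apply: eq_bigr => i _.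
    by rewrite !mxE; field.
  rewrite /expo l l'; move: q; set u := dotv (2^-1 *: _) _; move=> q.
  have -> : u = (dotv x x + dotv y y) / 2 - dotv (x - y) (x - y) / 4 by rewrite -q addrK.
  by field.
have h (z : R) : expR z = expR (z / 2) ^+ 2 by rewrite expr2 -expRD -splitr.
rewrite expRD (h (expo _ _ _ x)) (h (expo _ _ _ y)).
have := sqr_ge0 (expR (expo d e f x / 2) - expR (expo d e f y / 2)); nra.
Qed.

(** Comparison of the minimum with the value at the midpoint of [x] and [y]; this growth is the
    source of uniqueness and continuity of minimizers. *)
Lemma potential_growth d e F x y : 0 <= e -> minimizes d e F x ->
  potential d e F x * (1 + e / 4 * dotv (x - y) (x - y)) <= potential d e F y.
Proof.
move=> e0 mx; have := potential_midpoint d e F x y.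
have := mx (2^-1 *: (x + y)).
have p0 : 0 <= potential d e F x.
  by apply: sumr_ge0 => f _; rewrite mulr_ge0 ?sqr_ge0 ?expR_ge0.
have := expR_ge1Dx (e / 8 * dotv (x - y) (x - y)).
have : 0 <= e / 8 * dotv (x - y) (x - y) by rewrite mulr_ge0 ?divr_ge0 ?dotvv_ge0.
have -> : e / 4 * dotv (x - y) (x - y) = 2 * (e / 8 * dotv (x - y) (x - y)) by field.
set q := e / 8 * _; set E := expR q; move: (potential _ _ _ _) p0 => p p0 => q0 qE.
set p' := potential _ _ _ _; set p'' := potential _ _ _ _ => pp' pp''.
have : p * (1 + q) <= p' * E by apply: ler_pM => //; rewrite addr_ge0.
lra.
Qed.

Lemma minor_rescale F x f : minor (rescale F x) f ^+ 2 = minor F f ^+ 2 * expR (sumon f x).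
Proof.
rewrite /minor /rescale.
have -> : colsub f (F *m diag_mx (\row_i expR (x 0 i / 2))) =
    colsub f F *m diag_mx (\row_j expR (x 0 (f j) / 2)).
  by apply/matrixP => i j; rewrite !mul_mx_diag !mxE.
rewrite det_mulmx det_diag exprMn; congr (_ * _).
rewrite /sumon expR_sum -prodrXl; apply: eq_bigr => j _.
by rewrite mxE expr2 -expRD -splitr.
Qed.

Lemma gram_unit F : (F *m F^T \in unitmx) = (0 < \sum_f minor F f ^+ 2).
Proof.
have s0 : 0 <= \sum_f minor F f ^+ 2 by apply: sumr_ge0 => f _; exact: sqr_ge0.
rewrite lt_def s0 andbT unitmxE unitfE -gram_det mulf_eq0 pnatr_eq0.
by rewrite eqn0Ngt fact_gt0.
Qed.

Lemma minimizer_stationary d e F x i : minimizes d e F x ->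
  \sum_f minor F f ^+ 2 * expR (expo d e f x) * ((hits f i)%:R - d 0 i + e * x 0 i) = 0.
Proof.
move=> mx.
(* Restricted to a coordinate line, each term is a constant times the exponential of a quadratic
   polynomial in [s]. *)
pose g (s : R) := potential d e F (x + s *: delta_mx 0 i).
have gE s : g s = \sum_f minor F f ^+ 2 * expR (expo d e f x) *
    expR (s * ((hits f i)%:R - d 0 i + e * x 0 i) + e / 2 * s ^+ 2).
  apply: eq_bigr => f _; rewrite -mulrA -expRD; congr (_ * expR _).
  have E (u : 'rV[R]_n) : dotv u (delta_mx 0 i) = u 0 i.
    rewrite /dotv (bigD1 i)//= mxE !eqxx mulr1 big1 ?addr0// => j ji.
    by rewrite mxE (negbTE ji) andbF mulr0.
  have Dr (u v w : 'rV[R]_n) : dotv u (v + s *: w) = dotv u v + s * dotv u w.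
    by rewrite /dotv mulr_sumr -big_split/=; apply: eq_bigr => j _; rewrite !mxE; ring.
  have C (u v : 'rV[R]_n) : dotv u v = dotv v u.
    by apply: eq_bigr => j _; rewrite mulrC.
  have S : sumon f (x + s *: delta_mx 0 i) = sumon f x + s * (hits f i)%:R.
    rewrite !sumon_hits.
    have -> (u : 'rV[R]_n) : \sum_j u 0 j * (hits f j)%:R = dotv (\row_j (hits f j)%:R) u.
      by apply: eq_bigr => j _; rewrite mxE mulrC.
    rewrite Dr E mxE; congr (_ + _).
    by apply: eq_bigr => j _; rewrite mxE mulrC.
  rewrite /expo S !Dr E ![dotv (x + _) _]C !Dr ![dotv (delta_mx _ _) _]C !E !mxE !eqxx /= mulr1.
  by field.
have hd (t : R) f : is_derive t 1 (fun s : R => minor F f ^+ 2 * expR (expo d e f x) *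
    expR (s * ((hits f i)%:R - d 0 i + e * x 0 i) + e / 2 * s ^+ 2))
    (minor F f ^+ 2 * expR (expo d e f x) *
     (expR (t * ((hits f i)%:R - d 0 i + e * x 0 i) + e / 2 * t ^+ 2) *
     ((hits f i)%:R - d 0 i + e * x 0 i + e * t))).
  set a := (hits f i)%:R - _ + _.
  have q : is_derive t 1 (fun s : R => s * a + e / 2 * s ^+ 2) (a + e * t).
    apply: is_derive_eq; rewrite /GRing.scale /=. by field.
  exact: is_deriveZ.
have gd t := is_derive_sumT (hd t).
have gE' := funext gE.
have : is_derive (0 : R) 1 g 0.
  apply: (@derive1_at_min R g (-1) 1 0).
  - by lra.
  - by move=> t _; rewrite gE'.
  - by rewrite in_itv/= ltrN10 ltr01.
  - by move=> t _; rewrite /g scale0r addr0.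
rewrite gE' => -[_ D0]; have [_ D1] := gd 0.
rewrite [RHS](etrans (esym D0) D1).
apply: eq_bigr => f _; rewrite mul0r expr0n !mulr0 !addr0 expR0 mul1r.
by [].
Qed.

Lemma rescale_gram_unit d F x c : 0 <= c -> semistable_above d c F ->
  rescale F x *m (rescale F x)^T \in unitmx.
Proof.
move=> c0 /(_ 0)[f cf _]; rewrite gram_unit (bigD1 f)//=.
rewrite minor_rescale ltr_pwDl ?(mulr_gt0 (le_lt_trans c0 cf)) ?expR_gt0//.
by apply: sumr_ge0 => g _; exact: sqr_ge0.
Qed.

(** The part of the exponent independent of [f] cancels. Stationarity then gives the mean of
    [hits f i] under the squared minors of the rescaled matrix, and this mean is the diagonal entry
    by [rowproj_diag]. *)
Lemma minimizer_rowproj d e F x i c : minimizes d e F x -> 0 <= c ->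
  semistable_above d c F -> rowproj (rescale F x) i i = d 0 i - e * x 0 i.
Proof.
move=> mx c0 sF; have Fu := rescale_gram_unit x c0 sF.
have s0 : 0 < \sum_f minor (rescale F x) f ^+ 2 by rewrite -gram_unit.
have H := rowproj_diag i Fu.
apply: (mulIf (lt0r_neq0 s0)); rewrite H.
have := minimizer_stationary i mx.
have E f : expR (expo d e f x) = expR (sumon f x) * expR (- dotv d x + e / 2 * dotv x x).
  by rewrite -expRD addrA.
under eq_bigr do rewrite E mulrA -minor_rescale mulrAC.
rewrite -mulr_suml => /eqP; rewrite mulf_eq0 (gt_eqF (expR_gt0 _)) orbF => /eqP E0.
apply/eqP; rewrite -subr_eq0 -[X in _ == X]E0 mulr_sumr -sumrB; apply/eqP/eq_bigr => f _.
by ring.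
Qed.

(* The normalized squared minors of [F] are a probability distribution on bases
   whose mean indicator vector is [d]. *)
Lemma sum_minor_sumon d F x : F *m F^T \in unitmx -> schur_horn (rowproj F) = d ->
  \sum_f minor F f ^+ 2 * sumon f x = dotv d x * \sum_f minor F f ^+ 2.
Proof.
move=> Fu Fd; under eq_bigr do rewrite sumon_hits mulr_sumr.
rewrite exchange_big/= /dotv mulr_suml; apply: eq_bigr => i _.
rewrite -Fd mxE mulrAC (rowproj_diag _ Fu) mulrC mulr_sumr; apply: eq_bigr => f _.
by rewrite mulrCA mulrA.
Qed.

(** A mean does not exceed all the values: were [sumon f x] below [dotv d x] at every nonzero minor,
    the weighted mean would be below it too. *)
Lemma fibre_semistable d F : F *m F^T \in unitmx -> schur_horn (rowproj F) = d ->
  semistable_above d 0 F.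
Proof.
move=> Fu Fd x; apply: contrapT => nf.
have Fp := Fu; rewrite gram_unit in Fp.
have /eqP := sum_minor_sumon x Fu Fd; apply/negP; rewrite -subr_eq0 mulr_sumr -sumrB.
have le0 f : minor F f ^+ 2 * sumon f x - dotv d x * minor F f ^+ 2 <= 0.
  rewrite mulrC -mulrBl; have [->|m0] := eqVneq (minor F f) 0.
    by rewrite expr0n mulr0.
  rewrite mulr_le0_ge0 ?sqr_ge0// subr_le0 leNgt; apply/negP => /ltW h.
  by apply: nf; exists f => //; rewrite lt_def sqr_ge0 sqrf_eq0 m0.
rewrite lt_eqF//.
have [f f0] : exists f, 0 < minor F f ^+ 2.
  apply: contrapT => h; move: Fp; rewrite big1 ?ltxx// => f _.
  by apply/eqP; rewrite -[_ == _]negbK; apply/negP => m0; apply: h; exists f;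
    rewrite lt_def sqr_ge0 m0.
rewrite (bigD1 f)//= -[ltRHS]addr0 ltr_leD//; last first.
  by rewrite -oppr_ge0 -sumrN sumr_ge0// => g _; rewrite oppr_ge0.
rewrite mulrC -mulrBl pmulr_llt0// subr_lt0 ltNge; apply/negP => h.
by apply: nf; exists f.
Qed.

(** Since [expR t >= 1 + t], the potential lies above a sum whose linear terms average to 0 when the
    row space is in the fibre. *)
Lemma fibre_minimizes0 d e F : 0 <= e ->
  F *m F^T \in unitmx -> schur_horn (rowproj F) = d -> minimizes d e F 0.
Proof.
move=> e0 Fu Fd y; rewrite potential0.
apply: (@le_trans _ _ (\sum_f minor F f ^+ 2 * (1 + (sumon f y - dotv d y)))).
  under [leRHS]eq_bigr do rewrite mulrDr mulrBr mulr1.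
  rewrite big_split sumrB/= (sum_minor_sumon _ Fu Fd) mulr_sumr.
  rewrite lerDl subr_ge0; apply: ler_sum => f _; by rewrite mulrC.
apply: ler_sum => f _; rewrite ler_wpM2l ?sqr_ge0//.
apply: le_trans (expR_ge1Dx _); rewrite lerD2l /expo lerDl.
by rewrite mulr_ge0 ?divr_ge0 ?dotvv_ge0.
Qed.

End Potential.

(** * Limits of matrix-valued functions *)

Lemma cvg_sumT (R : realType) (T : Type) (I : finType) (D : set_system T)
    (h : I -> T -> R) (a : I -> R) : Filter D ->
  (forall i, h i t @[t --> D] --> a i) -> \sum_i h i t @[t --> D] --> \sum_i a i.
Proof. by move=> FD ha; apply: cvg_big => // ; exact: add_continuous. Qed.

Lemma cvg_prodT (R : realType) (T : Type) (I : finType) (D : set_system T)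
    (h : I -> T -> R) (a : I -> R) : Filter D ->
  (forall i, h i t @[t --> D] --> a i) -> \prod_i h i t @[t --> D] --> \prod_i a i.
Proof. by move=> FD ha; apply: cvg_big => // ; exact: mul_continuous. Qed.

Section MatrixLimits.
Context {R : realType} {T : Type} {D : set_system T} {FD : Filter D}.

Lemma cvg_mxP m n (G : T -> 'M[R]_(m, n)) (A : 'M[R]_(m, n)) :
  G t @[t --> D] --> A <-> forall i j, G t i j @[t --> D] --> A i j.
Proof.
split=> [GA i j|GA].
  by apply: (cvg_comp G (fun M : 'M[R]_(m, n) => M i j) GA); exact: coord_continuous.
move=> B [P AP PB].
have := filter_forall FD (fun i => filter_forall FD (fun j => GA i j _ (AP i j))).
by apply: filterS => t Pt; apply: PB => i j; exact: Pt.
Qed.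

Lemma cvg_trmx m n (G : T -> 'M[R]_(m, n)) (A : 'M[R]_(m, n)) :
  G t @[t --> D] --> A -> (G t)^T @[t --> D] --> A^T.
Proof.
move=> /cvg_mxP GA; apply/cvg_mxP => i j; rewrite mxE.
under eq_cvg do rewrite mxE.
exact: GA.
Qed.

Lemma cvg_mulmx m n p (G : T -> 'M[R]_(m, n)) (H : T -> 'M[R]_(n, p))
    (A : 'M[R]_(m, n)) (B : 'M[R]_(n, p)) :
  G t @[t --> D] --> A -> H t @[t --> D] --> B -> G t *m H t @[t --> D] --> A *m B.
Proof.
move=> /cvg_mxP GA /cvg_mxP HB; apply/cvg_mxP => i j; rewrite mxE.
under eq_cvg do rewrite mxE.
by apply: cvg_sumT => l; exact: cvgM.
Qed.

Lemma cvg_det n (G : T -> 'M[R]_n) (A : 'M[R]_n) :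
  G t @[t --> D] --> A -> \det (G t) @[t --> D] --> \det A.
Proof.
move=> /cvg_mxP GA; apply: cvg_sumT => s; apply: cvgM; first exact: cvg_cst.
by apply: cvg_prodT.
Qed.

Lemma cvg_invmx n (G : T -> 'M[R]_n) (A : 'M[R]_n) : A \in unitmx ->
  G t @[t --> D] --> A -> invmx (G t) @[t --> D] --> invmx A.
Proof.
move=> Au GA; have dA := cvg_det GA.
have d0 : \det A != 0 by move: Au; rewrite unitmxE unitfE.
(* Eventually the determinant is nonzero and [invmx] is given by the adjugate; elsewhere it has a
   default value. *)
suff : (\det (G t))^-1 *: \adj (G t) @[t --> D] --> invmx A.
  apply: cvg_trans; apply: near_eq_cvg.
  have : \forall t \near D, \det (G t) != 0.
    exact: cvgr_neq0 dA d0.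
  by apply: filterS => t t0; rewrite /invmx unitmxE unitfE t0.
rewrite /invmx Au; apply/cvg_mxP => i j; rewrite !mxE.
under eq_cvg do rewrite !mxE.
apply: cvgM; first exact: cvgV.
apply: cvgM; first exact: cvg_cst.
apply: cvg_det; apply/cvg_mxP => a b; rewrite !mxE.
under eq_cvg do rewrite !mxE.
by move/cvg_mxP : GA => GA; exact: GA.
Qed.

Lemma cvg_rowproj k n (G : T -> 'M[R]_(k, n)) (F : 'M[R]_(k, n)) : F *m F^T \in unitmx ->
  G t @[t --> D] --> F -> rowproj (G t) @[t --> D] --> rowproj F.
Proof.
move=> Fu GF; have GT := cvg_trmx GF.
apply: cvg_mulmx => //; apply: cvg_mulmx => //; apply: cvg_invmx => //.
exact: cvg_mulmx.
Qed.

Lemma cvg_minor k n (G : T -> 'M[R]_(k, n)) (F : 'M[R]_(k, n)) f :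
  G t @[t --> D] --> F -> minor (G t) f @[t --> D] --> minor F f.
Proof.
move=> /cvg_mxP GF; apply: cvg_det; apply/cvg_mxP => i j; rewrite mxE.
under eq_cvg do rewrite mxE.
exact: GF.
Qed.

Lemma cvg_rescale k n (G : T -> 'M[R]_(k, n)) (x : T -> 'rV[R]_n)
    (F : 'M[R]_(k, n)) (y : 'rV[R]_n) :
  G t @[t --> D] --> F -> x t @[t --> D] --> y ->
  rescale (G t) (x t) @[t --> D] --> rescale F y.
Proof.
move=> /cvg_mxP GF /cvg_mxP xy; apply/cvg_mxP => i j.
rewrite /rescale mul_mx_diag !mxE.
under eq_cvg do rewrite mul_mx_diag !mxE.
apply: cvgM; first exact: GF.
have h : x t 0 j / 2 @[t --> D] --> y 0 j / 2.
  by apply: cvgM; [exact: xy|exact: cvg_cst].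
by apply: continuous_cvg h; exact: continuous_expR.
Qed.

Lemma cvg_expo k n (d : 'rV[R]_n) e (f : {ffun 'I_k -> 'I_n}) (x : T -> 'rV[R]_n)
    (y : 'rV[R]_n) :
  x t @[t --> D] --> y -> expo d e f (x t) @[t --> D] --> expo d e f y.
Proof.
move=> /cvg_mxP xy.
apply: cvgD; first apply: cvgB.
- exact: cvg_sumT.
- by apply: cvg_sumT => i; apply: cvgM; [exact: cvg_cst|exact: xy].
- apply: cvgM; first exact: cvg_cst.
  by apply: cvg_sumT => i; apply: cvgM; exact: xy.
Qed.

Lemma cvg_potential k n d e (G : T -> 'M[R]_(k, n)) (x : T -> 'rV[R]_n)
    (F : 'M[R]_(k, n)) (y : 'rV[R]_n) :
  G t @[t --> D] --> F -> x t @[t --> D] --> y ->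
  potential d e (G t) (x t) @[t --> D] --> potential d e F y.
Proof.
move=> GF xy; apply: cvg_sumT => f; apply: cvgM.
  by rewrite expr2; apply: cvgM; exact: cvg_minor.
have h : expo d e f (x t) @[t --> D] --> expo d e f y by exact: cvg_expo.
by apply: continuous_cvg h; exact: continuous_expR.
Qed.

End MatrixLimits.

(** * Compactness of the Grassmannian and frames of its points *)

Lemma mx_box_compact (R : realType) m n (r : R) :
  compact [set A : 'M[R]_(m, n) | forall i j, `|A i j| <= r].
Proof.
have cp := @rV_compact R (m * n) (fun=> `[- r, r]%classic) (fun=> @segment_compact _ _ _).
have vc : continuous (@vec_mx R m n).
  move=> v; apply/(@cvg_mxP R _ _ (nbhs_filter v)) => i j.
  rewrite mxE; under eq_cvg do rewrite mxE.
  exact: coord_continuous.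
have := continuous_compact (continuous_subspaceT vc) cp.
rewrite (_ : _ @` _ = [set A : 'M[R]_(m, n) | forall i j, `|A i j| <= r])//.
apply/seteqP; split=> [_ [v vr <-] i j|A Ar].
  by rewrite mxE ler_norml; have := vr (mxvec_index i j); rewrite /= in_itv.
exists (mxvec A); last exact: mxvecK.
move=> l; rewrite -[A]mxvecK; case/mxvec_indexP : l => i j.
by rewrite /= mxvecK mxvecE in_itv/= -ler_norml.
Qed.

Lemma rowproj_grassmannian (R : realType) k n (F : 'M[R]_(k, n)) :
  F *m F^T \in unitmx -> grassmannian R n k (rowproj F).
Proof.
move=> Fu; split.
- by rewrite /rowproj !trmx_mul trmxK trmx_inv trmx_mul trmxK mulmxA.
- rewrite /rowproj -!mulmxA; congr (_ *m _).
  by rewrite !mulmxA -(mulmxA _ F F^T) mulVmx// mul1mx.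
- by rewrite /rowproj mxtrace_mulC mulmxA mulmxV// mxtrace1.
Qed.

Lemma grassmannian_frame (R : realType) k n (P : 'M[R]_n) : grassmannian R n k P ->
  exists2 F : 'M[R]_(k, n), F *m F^T \in unitmx & rowproj F = P.
Proof.
move=> [Ps PP trP].
have /eqP rP : \rank P == k by rewrite -(eqr_nat R) -trP (mxtrace_idem PP).
have [F Ff FP] : exists2 F : 'M[R]_(k, n), row_free F & (F :=: P)%MS.
  by rewrite -rP; exists (row_base P); [exact: row_base_free|exact: eq_row_base].
have Fu : F *m F^T \in unitmx.
  rewrite -row_free_unit -kermx_eq0; apply/eqP.
  set K := kermx _; have KF : K *m (F *m F^T) = 0 by exact: mulmx_ker.
  apply: (row_free_inj Ff); rewrite mul0mx.
  by apply: mulmx_tr_eq0; rewrite trmx_mul mulmxA -(mulmxA K) KF mul0mx.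
exists F => //.
have /submxP[C PC] : (P <= F)%MS by rewrite FP.
have /submxP[B FB] : (F <= P)%MS by rewrite FP.
have FPF : F *m P = F by rewrite FB -mulmxA PP.
have E : P = F^T *m C^T by rewrite -trmx_mul -PC Ps.
have -> : rowproj F = F^T *m invmx (F *m F^T) *m (F *m P) by rewrite FPF.
by rewrite {1}E !mulmxA -(mulmxA _ F F^T) mulmxKV// -E.
Qed.

Lemma grassmannian_closed (R : realType) n k : closed (grassmannian R n k).
Proof.
have -> : grassmannian R n k =
    [set P | P^T - P = 0] `&` [set P | P *m P - P = 0] `&` [set P | \tr P = k%:R].
  apply/seteqP; split=> [P [Ps PP tP]|P [[/= Ps PP] tP]].
    by split=> //; split; rewrite /= ?Ps ?PP subrr.
  by split=> //; apply/eqP; rewrite -subr_eq0; apply/eqP.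
have c0 : closed [set (0 : 'M[R]_n)].
  exact/accessible_closed_set1/hausdorff_accessible/norm_hausdorff.
apply: closedI; first apply: closedI.
- have c : continuous (fun P : 'M[R]_n => P^T - P).
    move=> P; have h : P'^T @[P' --> P] --> P^T.
      exact: (@cvg_trmx R _ _ (nbhs_filter P) _ _ id P).
    by apply: continuousB => //; exact: cvg_id.
  exact: (continuous_closedP _).1 c _ c0.
- have c : continuous (fun P : 'M[R]_n => P *m P - P).
    move=> P; have h : P' *m P' @[P' --> P] --> P *m P.
      exact: (@cvg_mulmx R _ _ (nbhs_filter P) _ _ _ id id P P).
    exact: (@cvgB _ _ _ _ (nbhs_filter P) (fun P' => P' *m P') id _ _ h (@cvg_id _ _)).
  exact: (continuous_closedP _).1 c _ c0.
- have c : continuous (fun P : 'M[R]_n => \tr P).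
    move=> P; apply: (@cvg_sumT R _ _ _ (fun i (P : 'M[R]_n) => P i i) _ (nbhs_filter P)) => i.
    exact: coord_continuous.
  exact: (continuous_closedP _).1 c _ (@closed_eq R _).
Qed.

(** A diagonal entry is the sum of the squares of its row, so [P a b ^+ 2 <= P a a <= 1]: the
    Grassmannian is closed in a compact box. *)
Lemma grassmannian_compact (R : realType) n k : compact (grassmannian R n k).
Proof.
apply: subclosed_compact (@grassmannian_closed R n k) (@mx_box_compact R n n 1) _.
move=> P [Ps PP _] i j.
have Pii a b : P a b ^+ 2 <= P a a.
  rewrite -[in leRHS]PP mxE (bigD1 b)//= -[in P b a]Ps mxE expr2 lerDl sumr_ge0// => l _.
  by rewrite -[in P l a]Ps mxE -expr2 sqr_ge0.
have P1 : P i i <= 1 by have := Pii i i; have := Pii i j; have := sqr_ge0 (P i j); nra.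
by rewrite -[leRHS]normr1 -ler_sqr ?nnegrE// !real_normK ?num_real// expr1n (le_trans (Pii i j)).
Qed.

(** * Existence, uniqueness and size of minimizers *)

Section Minimizers.
Context {R : realType} {k n : nat}.
Implicit Types (F G : 'M[R]_(k, n)) (d x y : 'rV[R]_n) (e c : R) (f : {ffun 'I_k -> 'I_n}).

Lemma dotv_ge_sqr x i : x 0 i ^+ 2 <= dotv x x.
Proof.
by rewrite /dotv (bigD1 i)//= expr2 lerDl sumr_ge0// => j _; rewrite -expr2 sqr_ge0.
Qed.

Lemma minimizer_exists d e c F : 0 < c -> 0 < e -> semistable_above d c F ->
  exists x, minimizes d e F x.
Proof.
move=> c0 e0 sF; pose M : R := \sum_f minor F f ^+ 2.
have M0 : 0 <= M by apply: sumr_ge0 => f _; exact: sqr_ge0.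
have ce0 : 0 < c * e by exact: mulr_gt0.
(* By [potential_ge] the potential exceeds its value [M] at 0 outside the box of radius [r]; the
   summand 1 ensures [r <= r ^+ 2]. *)
pose r := 1 + 2 * M / (c * e).
have r1 : 1 <= r by rewrite lerDl divr_ge0 ?mulr_ge0// ltW.
pose A := [set x : 'rV[R]_n | forall i j, `|x i j| <= r].
have A0 : A 0 by move=> i j; rewrite mxE normr0 (le_trans _ r1).
have cp : {within A, continuous (potential d e F)}.
  apply: continuous_subspaceT => x.
  exact: (@cvg_potential R _ _ (nbhs_filter x) _ _ d e (fun=> F) id _ _ (cvg_cst _) cvg_id).
have [x _ xmin] := compact_EVT_min (ex_intro _ _ A0) (@mx_box_compact R 1 n r) cp.
exists x => y; have [/mem_set/xmin//|/existsNP[i /existsNP[j /negP]]] := pselect (A y).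
rewrite -ltNge (ord1 i) => yr.
apply: (le_trans (xmin _ (mem_set A0))); rewrite potential0 -/M.
apply: le_trans (potential_ge y (ltW c0) (ltW e0) sF).
have : r <= dotv y y.
  apply: le_trans (dotv_ge_sqr y j); rewrite -real_normK ?num_real//; nra.
have -> : M = c * e / 2 * (2 * M / (c * e)).
  by field; rewrite !gt_eqF.
move=> ry; have -> : c * (1 + e / 2 * dotv y y) = c + c * e / 2 * dotv y y by field.
apply: (le_trans (y := c * e / 2 * dotv y y)); last by rewrite lerDr ltW.
rewrite ler_pM2l ?divr_gt0//; move: ry; rewrite /r; lra.
Qed.

Definition argmin d e F : 'rV[R]_n := xget 0 [set x | minimizes d e F x].

Lemma argminP d e c F : 0 < c -> 0 < e -> semistable_above d c F ->
  minimizes d e F (argmin d e F).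
Proof.
move=> c0 e0 sF; have [x mx] := minimizer_exists c0 e0 sF.
exact: (xgetPex 0 (ex_intro _ x mx)).
Qed.

(** Two minimizers share the same value, positive by [potential_ge], so the growth estimate forces
    their distance to be 0. *)
Lemma argmin_unique d e c F x : 0 < c -> 0 < e -> semistable_above d c F ->
  minimizes d e F x -> argmin d e F = x.
Proof.
move=> c0 e0 sF mx; have ma := argminP c0 e0 sF.
have := potential_growth x (ltW e0) ma.
have := potential_ge (argmin d e F) (ltW c0) (ltW e0) sF.
have := mx (argmin d e F); set q := potential _ _ _ _; set p := potential _ _ _ _.
set N := dotv _ _; set N' := dotv _ _ => qp pN pq.
have N0 : 0 <= N by exact: dotvv_ge0.
have N'0 : 0 <= N' by exact: dotvv_ge0.
have p0 : 0 < p.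
  by apply: lt_le_trans pN; rewrite mulr_gt0// ltr_wpDr// mulr_ge0// divr_ge0// ltW.
have : e / 4 * N' <= 0.
  have : p * (1 + e / 4 * N') <= p * 1 by rewrite mulr1 (le_trans pq).
  by rewrite ler_pM2l// gerDl.
rewrite pmulr_rle0 ?divr_gt0// => N'le0.
apply/rowP => i; apply/eqP; rewrite -subr_eq0 -sqrf_eq0 eq_le sqr_ge0 andbT.
by apply: le_trans N'le0; have := dotv_ge_sqr (argmin d e F - x) i; rewrite !mxE.
Qed.

(** Comparison with the value at 0. As the bound does not depend on [e], the defect [e x] of the
    diagonal tends to 0 with [e]. *)
Lemma argmin_bound d e c F : 0 < c -> 0 < e -> semistable_above d c F ->
  e / 2 * dotv (argmin d e F) (argmin d e F) <= (\sum_f minor F f ^+ 2) / c.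
Proof.
move=> c0 e0 sF; have ma := argminP c0 e0 sF.
have := ma 0; rewrite potential0 => h.
have := le_trans (potential_ge (argmin d e F) (ltW c0) (ltW e0) sF) h.
rewrite ler_pdivlMr// mulrC; move: (_ * dotv _ _) => q; move: (\sum_f _) => s.
by lra.
Qed.

Lemma expo_bound d e f x Q : 0 <= e -> dotv x x <= Q ->
  expo d e f x <= k%:R * (1 + Q) + (\sum_i `|d 0 i|) * (1 + Q) + e / 2 * Q.
Proof.
move=> e0 xQ.
(* [1 + Q] serves as a bound for the square root of [Q]. *)
have xi i : `|x 0 i| <= 1 + Q.
  have := le_trans (dotv_ge_sqr x i) xQ; rewrite -real_normK ?num_real//.
  by have := normr_ge0 (x 0 i); nra.
apply: lerD; last by rewrite ler_wpM2l// divr_ge0.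
apply: lerD.
  apply: (le_trans (y := \sum_(j < k) (1 + Q))).
    by apply: ler_sum => j _; exact: le_trans (ler_norm _) (xi _).
  by rewrite sumr_const card_ord mulr_natl.
rewrite /dotv -sumrN mulr_suml; apply: ler_sum => i _.
by rewrite (le_trans (ler_norm _))// normrN normrM ler_wpM2l.
Qed.

Definition seg F G (t : R) : 'M[R]_(k, n) := F + t *: (G - F).

Lemma seg0 F G : seg F G 0 = F.
Proof. by rewrite /seg scale0r addr0. Qed.

Lemma seg1 F G : seg F G 1 = G.
Proof. by rewrite /seg scale1r addrC subrK. Qed.

Lemma continuous_seg F G : continuous (seg F G).
Proof.
move=> t; apply/(@cvg_mxP R _ _ (nbhs_filter t)) => i j; rewrite !mxE.
under eq_cvg do rewrite !mxE.
by apply: cvgD; [exact: cvg_cst|apply: cvgM; [exact: cvg_id|exact: cvg_cst]].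
Qed.

Lemma continuous_minor_seg F G f : continuous (fun t => minor (seg F G t) f ^+ 2).
Proof.
move=> t; have h : minor (seg F G t') f @[t' --> t] --> minor (seg F G t) f.
  exact: (@cvg_minor R _ _ (nbhs_filter t) _ _ _ _ _ (@continuous_seg F G t)).
exact: (cvgM h h).
Qed.

(** The infinitely many [x] produce only finitely many sets of bases. For each of them the sum of
    the squared minors is continuous and positive on the segment, hence bounded below, and one small
    [c] serves all. *)
Lemma semistable_above_seg d F G :
  (forall t : R, t \in `[0, 1] -> semistable_above d 0 (seg F G t)) ->
  exists2 c, 0 < c & forall t : R, t \in `[0, 1] -> semistable_above d c (seg F G t).
Proof.
move=> sS; pose bases x := [set f : {ffun 'I_k -> 'I_n} | dotv d x <= sumon f x]%SET.
have key (S : {set {ffun 'I_k -> 'I_n}}) : \forall c \near (0 : R)^'+,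
    forall t : R, t \in `[0, 1] -> (exists x, S = bases x) -> exists2 f, f \in S & c < minor (seg F G t) f ^+ 2.
  have [[x Sx]|nS] := pselect (exists x, S = bases x); last first.
    by apply: nearW => c t _ /nS.
  pose g t := \sum_(f in S) minor (seg F G t) f ^+ 2.
  have cg : {within `[0, 1], continuous g}.
    apply: continuous_subspaceT; apply: continuous_big; first exact: add_continuous.
    by move=> f _; exact: continuous_minor_seg.
  have [t0 t01 gmin] := EVT_min (@ler01 R) cg.
  have g0 : 0 < g t0.
    have [f f0 fx] := sS _ t01 x.
    rewrite /g (bigD1 f)/=; last by rewrite Sx inE.
    by rewrite ltr_pwDl// sumr_ge0// => h _; exact: sqr_ge0.
  near=> c => t t1 _; apply: contrapT => nf.
  have : g t <= \sum_(f in S) c.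
    by apply: ler_sum => f fS; rewrite leNgt; apply/negP => cf; apply: nf; exists f.
  apply/negP; rewrite -ltNge sumr_const -mulr_natr; apply: lt_le_trans (gmin t t1).
  apply: (@le_lt_trans _ _ (c * (#|S|.+1)%:R)).
    by rewrite ler_wpM2l ?ler_nat//; apply: ltW; near: c; exact: nbhs_right_gt.
  by rewrite -ltr_pdivlMr//; near: c; apply: nbhs_right_lt; exact: divr_gt0.
have [c [c0 cS]] : exists c : R, 0 < c /\ forall S, forall t : R, t \in `[0, 1] ->
    (exists x, S = bases x) -> exists2 f, f \in S & c < minor (seg F G t) f ^+ 2.
  apply: (@filter_ex _ ((0 : R)^'+)); apply: filterI; first exact: nbhs_right_gt.
  exact: (filter_forall _ key).
exists c => // t t1 x; have [f] := cS (bases x) t t1 (ex_intro _ x erefl).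
by rewrite inE => fx cf; exists f.
Unshelve. all: by end_near. Qed.

End Minimizers.

(** * Minimizers along a segment and the crossing argument *)

Section Crossing.
Context {R : realType} {k n : nat}.
Implicit Types (F G : 'M[R]_(k, n)) (d x y : 'rV[R]_n) (e c : R) (f : {ffun 'I_k -> 'I_n}).

Lemma gram_seg_bound F G : exists2 M : R, 0 <= M &
  forall t : R, t \in `[0, 1] -> \sum_f minor (seg F G t) f ^+ 2 <= M.
Proof.
have cg : {within `[0, 1], continuous (fun t => \sum_f minor (seg F G t) f ^+ 2)}.
  apply: continuous_subspaceT; apply: continuous_big; first exact: add_continuous.
  by move=> f _; exact: continuous_minor_seg.
have [t0 _ gmax] := EVT_max (@ler01 R) cg.
exists (\sum_f minor (seg F G t0) f ^+ 2) => //.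
by apply: sumr_ge0 => f _; exact: sqr_ge0.
Qed.

(* Quadratic growth of [potential] around its minimizer turns closeness of the
   potentials, uniform on bounded sets, into closeness of the minimizers. *)
Lemma argmin_seg_continuous d e c F G (t0 : R) : 0 < c -> 0 < e ->
  (forall t : R, t \in `[0, 1] -> semistable_above d c (seg F G t)) ->
  t0 \in `[0, 1] ->
  argmin d e (seg F G t) @[t --> within `[0, 1]%classic (nbhs t0)] -->
    argmin d e (seg F G t0).
Proof.
move=> c0 e0 sS t01.
have [M M0 FM] := gram_seg_bound F G.
pose Q := 2 * M / (c * e).
pose a t := argmin d e (seg F G t).
have aQ t : t \in `[0, 1] -> dotv (a t) (a t) <= Q.
  move=> t1; have := argmin_bound c0 e0 (sS _ t1); rewrite -/(a t) => h.
  have {}h := le_trans h (ler_wpM2r _ (FM t t1)).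
  rewrite /Q ler_pdivlMr ?mulr_gt0//; move: h; rewrite invr_ge0 (ltW c0) => /(_ isT).
  by rewrite ler_pdivlMr//; lra.
pose B := expR (k%:R * (1 + Q) + (\sum_i `|d 0 i|) * (1 + Q) + e / 2 * Q).
(* The last summand bounds the change of the potential at [a t] when the matrix at [t] is replaced
   by the one at [t0]. Growth at [t0] and minimality at [t] then control the distance from [a t0] to
   [a t] by [r t]. *)
pose r t := potential d e (seg F G t) (a t0) - potential d e (seg F G t0) (a t0) +
  (\sum_f `|minor (seg F G t0) f ^+ 2 - minor (seg F G t) f ^+ 2|) * B.
have ra t : t \in `[0, 1] -> e / 4 * c * dotv (a t0 - a t) (a t0 - a t) <= r t.
  move=> t1.
  have := potential_growth (a t) (ltW e0) (argminP c0 e0 (sS _ t01)).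
  rewrite -/(a t0).
  have := potential_ge (a t0) (ltW c0) (ltW e0) (sS _ t01).
  have := argminP c0 e0 (sS _ t1) (a t0); rewrite -/(a t).
  have : potential d e (seg F G t0) (a t) - potential d e (seg F G t) (a t) <=
      (\sum_f `|minor (seg F G t0) f ^+ 2 - minor (seg F G t) f ^+ 2|) * B.
    rewrite /potential -sumrB mulr_suml; apply: ler_sum => f _.
    rewrite -mulrBl; apply: (le_trans (ler_norm _)).
    rewrite normrM ler_wpM2l// ger0_norm ?expR_ge0// ler_expR.
    by apply: expo_bound; [exact: ltW|exact: aQ].
  rewrite /r; set D := (\sum_f _) * B.
  set N := dotv (a t0 - _) _; have N0 : 0 <= N := dotvv_ge0 _.
  have N0' := dotvv_ge0 (a t0).
  move: (potential _ _ _ (a t0)) (potential _ _ _ (a t0))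
    (potential _ _ _ (a t)) (potential _ _ _ (a t)).
  move=> p1 p2 p3 p4 h1 h2 h3 h4.
  have c1 : c <= p1.
    by apply: le_trans h3; rewrite ler_peMr ?(ltW c0)// lerDl mulr_ge0// divr_ge0// ltW.
  have : e / 4 * c * N <= e / 4 * p1 * N.
    by rewrite ler_wpM2r// ler_wpM2l// divr_ge0// ltW.
  lra.
have rc : r t @[t --> within `[0, 1]%classic (nbhs t0)] --> (0 : R).
  have h : potential d e (seg F G t) (a t0) @[t --> t0] --> potential d e (seg F G t0) (a t0).
    exact: (@cvg_potential R _ _ (nbhs_filter t0) _ _ d e _ (fun=> a t0) _ _
      (@continuous_seg _ _ _ F G t0) (cvg_cst _)).
  have cc (u : R) : u @[_ --> t0] --> u by exact: cvg_cst.
  have h1 := @cvgB _ _ _ _ (nbhs_filter t0) _ _ _ _ h (cc (potential d e (seg F G t0) (a t0))).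
  have h2 f : `|minor (seg F G t0) f ^+ 2 - minor (seg F G t) f ^+ 2| @[t --> t0] -->
      `|minor (seg F G t0) f ^+ 2 - minor (seg F G t0) f ^+ 2|.
    apply: cvg_norm; apply: cvgB; first exact: cvg_cst.
    exact: continuous_minor_seg.
  have h3 := @cvgM _ _ _ (nbhs_filter t0) _ _ _ _ (cvg_sumT (nbhs_filter t0) h2) (cc B).
  have := @cvgD _ _ _ _ (nbhs_filter t0) _ _ _ _ h1 h3.
  rewrite subrr add0r big1 ?mul0r => [|f _]; last by rewrite subrr normr0.
  exact: cvg_within_filter.
apply/(@cvg_mxP R) => i j; rewrite (ord1 i).
apply/cvgrPdist_lt => eta eta0.
have K0 : 0 < e / 4 * c * eta ^+ 2 by rewrite !mulr_gt0// divr_gt0.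
near=> t.
have t1 : t \in `[0, 1] by near: t; exact: withinT.
have rt : r t < e / 4 * c * eta ^+ 2 by near: t; exact: (cvgr_lt _ rc).
have := le_lt_trans (ra t t1) rt; rewrite ltr_pM2l ?mulr_gt0 ?divr_gt0//.
move=> /(le_lt_trans (dotv_ge_sqr _ j)); rewrite !mxE -real_normK ?num_real//.
by rewrite ltr_sqr ?nnegrE// ltW.
Unshelve. all: by end_near. Qed.

(* If [F] is semistable, the diagonal of [shadow d e F] tends to [d] with [e --> 0]. *)
Definition shadow d e F : 'M[R]_n := rowproj (rescale F (argmin d e F)).

Lemma shadow_grassmannian d e c F : 0 <= c -> semistable_above d c F ->
  grassmannian R n k (shadow d e F).
Proof. by move=> c0 sF; exact/rowproj_grassmannian/(rescale_gram_unit _ c0 sF). Qed.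

Lemma shadow_fibre d e F : 0 < e -> F *m F^T \in unitmx ->
  schur_horn (rowproj F) = d -> shadow d e F = rowproj F.
Proof.
move=> e0 Fu Fd; have s0 := fibre_semistable Fu Fd.
(* The constant segment provides a positive [c]. *)
have [|c c0 sc] := @semistable_above_seg R k n d F F.
  by move=> t _; rewrite /seg subrr scaler0 addr0.
have sF : semistable_above d c F by rewrite -(seg0 F F); apply: sc; rewrite in_itv/= lexx ler01.
rewrite /shadow (argmin_unique c0 e0 sF (fibre_minimizes0 (ltW e0) Fu Fd)).
congr rowproj; rewrite /rescale.
have -> : \row_i expR ((0 : 'rV[R]_n) 0 i / 2) = const_mx 1.
  by apply/rowP => i; rewrite !mxE mul0r expR0.
by rewrite diag_const_mx mulmx1.
Qed.

Lemma same_side_of_no_crossing (u v r : R) :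
  ~ (Num.min u v <= r <= Num.max u v) -> (u < r) = (v < r).
Proof.
move=> uvr; have [ur|ru] := ltrP u r; have [vr|rv] := ltrP v r => //; case: uvr.
  by rewrite ge_min (ltW ur) le_max rv orbT.
by rewrite ge_min le_max ru (ltW vr) orbT.
Qed.

(** For small [e] all shadows along the segment have diagonals so close to [d] that [h] avoids 1/2
    on them; the shadow being continuous in [t], the intermediate value theorem keeps [h] on one
    side. *)
Lemma shadow_same_side d (h : 'M[R]_n -> R) (eta : R) F G : continuous h -> 0 < eta ->
  (forall P, grassmannian R n k P -> \sum_i (d 0 i - P i i) ^+ 2 < eta -> h P != 1 / 2) ->
  (forall t : R, t \in `[0, 1] -> semistable_above d 0 (seg F G t)) ->
  \forall e \near 0^'+, (h (shadow d e F) < 1 / 2) = (h (shadow d e G) < 1 / 2).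
Proof.
move=> hc eta0 hP s0; have [c c0 sS] := semistable_above_seg s0.
have [M M0 FM] := gram_seg_bound F G.
near=> e.
have e0 : 0 < e by near: e; exact: nbhs_right_gt.
(* The squared distance to [d] is [e ^+ 2 * dotv x x], at most [e * (2 * M / c)]; the added 1 keeps
   the denominator positive if [M] is 0. *)
have eM : e < eta / (2 * M / c + 1).
  near: e; apply: nbhs_right_lt; rewrite divr_gt0// ltr_wpDl// divr_ge0 ?mulr_ge0//; exact: ltW.
have ne t : t \in `[0, 1] -> h (shadow d e (seg F G t)) != 1 / 2.
  move=> t1; apply: hP; first exact: shadow_grassmannian (ltW c0) (sS t t1).
  have am := argminP c0 e0 (sS t t1).
  set x := argmin d e _ in am.
  have -> : \sum_i (d 0 i - shadow d e (seg F G t) i i) ^+ 2 = e ^+ 2 * dotv x x.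
    rewrite /dotv mulr_sumr; apply: eq_bigr => i _.
    by rewrite (minimizer_rowproj i am (ltW c0) (sS t t1)) opprB addrC subrK exprMn expr2 expr2.
  have := argmin_bound c0 e0 (sS t t1); rewrite -/x => xM.
  have {}xM : e / 2 * dotv x x <= M / c.
    by apply: le_trans xM _; rewrite ler_wpM2r ?invr_ge0 ?FM// ltW.
  apply: (@le_lt_trans _ _ (e * (2 * M / c))).
    have -> : e ^+ 2 * dotv x x = e * (2 * (e / 2 * dotv x x)) by field.
    by rewrite ler_pM2l// -[leRHS]mulrA ler_pM2l.
  apply: (@lt_trans _ _ (e * (2 * M / c + 1))).
    by rewrite ltr_pM2l// ltrDl.
  by rewrite -ltr_pdivlMr// ltr_wpDl// divr_ge0 ?mulr_ge0//; exact: ltW.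
pose phi t := h (shadow d e (seg F G t)).
have phic : {within `[0, 1], continuous phi}.
  apply/subspace_continuousP => t t1.
  apply: (@continuous_cvg _ _ _ _ _ (fun t => shadow d e (seg F G t)) h); first exact: hc.
  apply: cvg_rowproj; first exact: rescale_gram_unit (ltW c0) (sS t t1).
  apply: cvg_rescale; last exact: argmin_seg_continuous c0 e0 sS t1.
  by apply: cvg_within_filter; exact: continuous_seg.
have := IVT (v := 1 / 2) ler01 phic; rewrite /phi seg0 seg1.
move=> ivt.
apply: same_side_of_no_crossing => /ivt[t t1 /eqP].
by apply/negP; exact: ne.
Unshelve. all: by end_near. Qed.

End Crossing.

(** * Generic moves of one column and the exchange condition *)

Section Columns.
Context {R : realType} {k n : nat}.
Implicit Types (F G H : 'M[R]_(k, n)) (d x : 'rV[R]_n) (w : 'cV[R]_k)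
  (f g : {ffun 'I_k -> 'I_n}).

Definition uniform_mx F := forall f, injective f -> minor F f != 0.

(* As it only forbids two minors to vanish simultaneously, this fails in
   codimension 2, so that generic paths satisfy it. *)
Definition exchange_mx F := forall f g (i : 'I_k), injective f -> injective g ->
  (forall j, j != i -> f j = g j) -> f i != g i ->
  (minor F f != 0) || (minor F g != 0).

Lemma uniform_exchange F : uniform_mx F -> exchange_mx F.
Proof. by move=> uF f g i fi _ _ _; rewrite uF. Qed.

Definition setcol F (j : 'I_n) w : 'M[R]_(k, n) :=
  \matrix_(a, b) if b == j then w a 0 else F a b.

Lemma minor_setcol_notin F j w f : (forall i, f i != j) -> minor (setcol F j w) f = minor F f.
Proof.
move=> fj; congr (\det _); apply/matrixP => a b; rewrite !mxE.
by rewrite (negbTE (fj b)).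
Qed.

(** Laplace expansion: a linear form in [w] whose coefficients do not involve column [j]. *)
Lemma minor_setcol F j w f (i : 'I_k) : injective f -> f i = j ->
  minor (setcol F j w) f = \sum_a w a 0 * cofactor (colsub f F) a i.
Proof.
move=> fi fij; rewrite /minor (expand_det_col _ i); apply: eq_bigr => a _.
rewrite !mxE fij eqxx; congr (_ * _); rewrite /cofactor; congr (_ * \det _).
apply/matrixP => b c; rewrite !mxE -fij (inj_eq fi).
by rewrite eq_sym (negbTE (neq_lift _ _)).
Qed.

Lemma setcol_col F j : setcol F j (col j F) = F.
Proof. by apply/matrixP => a b; rewrite !mxE; case: eqP => // ->. Qed.

(** Only one column moves, so minors are affine in [t]. *)
Lemma minor_seg_setcol F j w f (t : R) : injective f ->
  minor (seg F (setcol F j w) t) f = (1 - t) * minor F f + t * minor (setcol F j w) f.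
Proof.
move=> fi; have -> : seg F (setcol F j w) t = setcol F j ((1 - t) *: col j F + t *: w).
  by apply/matrixP => a b; rewrite !mxE; case: eqP => [->|_]; ring.
have [[i fij]|nf] := pselect (exists i, f i = j).
  rewrite -[in minor F f](setcol_col F j) !(minor_setcol _ _ fi fij) !mulr_sumr -big_split/=.
  by apply: eq_bigr => a _; rewrite !mxE; ring.
have {}nf i : f i != j by apply/eqP => fij; apply: nf; exists i.
by rewrite !(minor_setcol_notin _ _ nf); ring.
Qed.

Lemma poly_nonroot (p : {poly R}) : p != 0 -> exists u, p.[u] != 0.
Proof.
by move=> p0; exists (cauchy_bound p); apply/eqP => /(cauchy_boundP p0); rewrite ltNge ler_norm.
Qed.

Lemma avoid_hyperplanes (I : finType) (P : pred I) (phi : I -> 'cV[R]_k -> R) :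
  (forall i, P i -> exists c : 'I_k -> R, forall w, phi i w = \sum_a w a 0 * c a) ->
  (forall i, P i -> exists w, phi i w != 0) ->
  exists w, forall i, P i -> phi i w != 0.
Proof.
(* The moment curve is not contained in any finite union of hyperplanes. *)
move=> lin nz.
have lin' i : exists c : 'I_k -> R, P i -> forall w, phi i w = \sum_a w a 0 * c a.
  by have [/lin[c hc]|] := boolP (P i); [exists c|exists (fun=> 0)].
have [c hc] := choice lin'.
pose p i : {poly R} := \sum_a c i a *: 'X^a.
have pc i (a : 'I_k) : (p i)`_a = c i a.
  rewrite coef_sum (bigD1 a)//= coefZ coefXn eqxx mulr1 big1 ?addr0// => b ba.
  by rewrite coefZ coefXn -[_ == _]/(a == b) eq_sym (negbTE ba) mulr0.
have pN0 : \prod_(i | P i) p i != 0.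
  apply/prodf_neq0 => i Pi; have [w] := nz _ Pi; apply: contraNneq => pi0.
  by rewrite (hc _ Pi) big1// => a _; rewrite -pc pi0 coef0 mulr0.
have [u pu] := poly_nonroot pN0; exists (\col_a u ^+ a) => i Pi.
move: pu; rewrite horner_prod => /prodf_neq0/(_ i Pi); rewrite /p horner_sum (hc _ Pi).
under eq_bigr do rewrite hornerZ hornerXn mulrC.
by under [in X in _ -> X]eq_bigr do rewrite mxE.
Qed.

(** The exchange pairs whose two minors both depend on column [j]: it sits at position [i] in both,
    and the exchange happens at [i']. *)
Definition adjacent_at (j : 'I_n) f g : bool :=
  [&& injectiveb f, injectiveb g & [exists i, exists i', [&& f i == j, g i == j, i' != i,
    f i' != g i' & [forall l, (l != i') ==> (f l == g l)]]]].

Lemma generic_column F G (j : 'I_n) : uniform_mx F -> uniform_mx G ->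
  exists w, [/\ uniform_mx (setcol F j w), uniform_mx (setcol G j w),
    forall t, exchange_mx (seg F (setcol F j w) t) &
    forall t, exchange_mx (seg G (setcol G j w) t)].
Proof.
(* Treating [F] and [G] at once yields a single [w] for both. *)
move=> uF uG; pose E b := if b then F else G.
have uE b : uniform_mx (E b) by case: b.
pose I := (bool * {ffun 'I_k -> 'I_n} + bool * {ffun 'I_k -> 'I_n} * {ffun 'I_k -> 'I_n})%type.
pose P (i : I) := match i with
  | inl (b, f) => injectiveb f && [exists i, f i == j]
  | inr (b, f, g) => adjacent_at j f g end.
(* The second case is the determinant formed by the end values of two affine functions of [t]; if it
   is nonzero, they have no common zero. *)
pose phi (i : I) w := match i with
  | inl (b, f) => minor (setcol (E b) j w) f
  | inr (b, f, g) => minor (E b) f * minor (setcol (E b) j w) g -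
                     minor (E b) g * minor (setcol (E b) j w) f end.
have [w hw] : exists w, forall i, P i -> phi i w != 0.
  apply: avoid_hyperplanes.
    move=> [[b f]|[[b f] g]] /=.
      move=> /andP[/injectiveP fi /existsP[i /eqP fij]].
      by exists (fun a => cofactor (colsub f (E b)) a i) => w; exact: minor_setcol.
    move=> /and3P[/injectiveP fi /injectiveP gi].
    move=> /existsP[i /existsP[i' /and5P[/eqP fij /eqP gij _ _ _]]].
    exists (fun a => minor (E b) f * cofactor (colsub g (E b)) a i -
        minor (E b) g * cofactor (colsub f (E b)) a i) => w.
    rewrite (minor_setcol _ _ fi fij) (minor_setcol _ _ gi gij) !mulr_sumr -sumrB.
    by apply: eq_bigr => a _; ring.
  move=> [[b f]|[[b f] g]] /=.
    move=> /andP[/injectiveP fi _].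
    by exists (col j (E b)); rewrite setcol_col; exact: uE.
  move=> /and3P[/injectiveP fi /injectiveP gi].
  move=> /existsP[i /existsP[i' /and5P[/eqP fij /eqP gij i'i fg /forallP fgl]]].
  have {}fgl l : l != i' -> f l = g l by move=> li; apply/eqP; exact: implyP (fgl l) li.
  (* With this column repeated at [j], the minor at [f] vanishes and the one at [g] becomes the
     minor of [E b] at the injective map [g']. *)
  exists (col (f i') (E b)).
  have fi'j : f i' != j by rewrite -fij (inj_eq fi).
  have -> : minor (setcol (E b) j (col (f i') (E b))) f = 0.
    rewrite /minor -det_tr; apply: (determinant_alternate i'i) => l.
    by rewrite !mxE fij eqxx (negbTE fi'j).
  pose g' := [ffun l => if l == i then f i' else g l].
  have -> : minor (setcol (E b) j (col (f i') (E b))) g = minor (E b) g'.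
    congr (\det _); apply/matrixP => a c; rewrite !mxE ffunE -gij (inj_eq gi).
    by case: (c == i).
  have g'i : injective g'.
    have key l : l != i -> f i' != g l.
      move=> li; have [->//|li'] := eqVneq l i'.
      by rewrite -fgl// (inj_eq fi) eq_sym.
    move=> l m; rewrite !ffunE.
    have [->|li] := eqVneq l i; have [->|mi] := eqVneq m i => //.
    - by move=> /eqP; rewrite (negbTE (key _ mi)).
    - by move=> /esym/eqP; rewrite (negbTE (key _ li)).
    - exact: gi.
  by rewrite mulr0 subr0 mulf_neq0// uE.
have uw b : uniform_mx (setcol (E b) j w).
  move=> f fi; have [[i fij]|nf] := pselect (exists i, f i = j).
    apply: (hw (inl (b, f))); apply/andP; split; first exact/injectiveP.
    by apply/existsP; exists i; apply/eqP.
  by rewrite minor_setcol_notin ?uE// => i; apply/eqP => fij; apply: nf; exists i.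
have ew b t : exchange_mx (seg (E b) (setcol (E b) j w) t).
  move=> f g i' fi gi fgl fg; rewrite -negb_and; apply/negP => /andP[/eqP f0 /eqP g0].
  (* A minor not involving column [j] is constant along the segment, hence nonzero. *)
  have inj_hits (h : {ffun 'I_k -> 'I_n}) : injective h ->
      minor (seg (E b) (setcol (E b) j w) t) h = 0 -> exists i, h i = j.
    move=> hi h0; apply: contrapT => nh.
    have {}nh i : h i != j by apply/eqP => hij; apply: nh; exists i.
    move: h0; rewrite minor_seg_setcol// minor_setcol_notin// => /eqP; apply/negP.
    by rewrite -mulrDl subrK mul1r uE.
  have [i fij] := inj_hits _ fi f0; have [l glj] := inj_hits _ gi g0.
  have ii' : i != i'.
    apply: contraNneq fg => ii'; rewrite -ii' fij; apply/eqP.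
    have [li|li] := eqVneq l i'; first by rewrite ii' -li.
    by have := fgl _ li; rewrite glj -fij => /fi li0; rewrite li0 ii' eqxx in li.
  have gij : g i = j by rewrite -fgl.
  have : phi (inr (b, f, g)) w != 0.
    apply: hw; apply/and3P; split; [exact/injectiveP|exact/injectiveP|].
    apply/existsP; exists i; apply/existsP; exists i'.
    rewrite fij gij !eqxx eq_sym ii' fg /=; apply/forallP => m; apply/implyP => mi.
    by apply/eqP; exact: fgl.
  rewrite /phi; move: f0 g0; rewrite !minor_seg_setcol//.
  move: (minor _ f) (minor _ f) (minor _ g) (minor _ g) => a' a c' c f0 g0.
  suff -> : a * c' - c * a' = 0 by rewrite eqxx.
  have -> : a * c' - c * a' = ((1 - t) * a + t * a') * (c' - c) -
      ((1 - t) * c + t * c') * (a' - a) by ring.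
  by rewrite f0 g0 !mul0r subrr.
by exists w; split; [exact: (uw true)|exact: (uw false)|exact: (ew true)|exact: (ew false)].
Qed.

End Columns.

(* Order the coordinates of [x] decreasingly: if the [k] first indices do not form
   a basis, the [k]-th can be exchanged for the next one, and the hypothesis on
   the sums of [n - k] entries of [d] is what makes up for the loss. *)
Lemma exchange_semistable (R : realType) (n k : nat) (d : 'rV[R]_n) (F : 'M[R]_(k, n)) :
  (0 < k < n)%N -> hypersimplex R n k d ->
  (forall i : 'I_(n - k) -> 'I_n, injective i -> 1 <= \sum_(j < n - k) d 0 (i j)) ->
  exchange_mx F -> semistable_above d 0 F.
Proof.
case: k F => [//|k] F /andP[_ kn] [d01 dk] dsum exF x.
(* From here on, the [k] of the statement is [k.+1]; bases have positions 0 to [k]. *)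
have d0 i : 0 <= d 0 i by case/andP: (d01 i).
have d1 i : d 0 i <= 1 by case/andP: (d01 i).
have n0 : (0 < n)%N by apply: leq_trans kn.
pose i0 := Ordinal n0.
pose geq : rel 'I_n := fun i j => x 0 j <= x 0 i.
have geq_total : total geq by move=> i j; exact: le_total.
have geq_trans : transitive geq by move=> i j l; rewrite /geq => ji il; exact: le_trans il ji.
pose s := sort geq (enum 'I_n).
have sn : size s = n by rewrite size_sort size_enum_ord.
have su : uniq s by rewrite sort_uniq enum_uniq.
have ss : sorted geq s by exact: sort_sorted.
pose sg := nth i0 s.
have sg_inj a b : (a < n)%N -> (b < n)%N -> sg a = sg b -> a = b.
  by move=> an bn /eqP; rewrite nth_uniq ?sn// => /eqP.
pose Y m := x 0 (sg m); pose e m := d 0 (sg m).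
have Ymono a b : (a <= b)%N -> (b < n)%N -> Y b <= Y a.
  move=> ab bn; have := sorted_leq_nth geq_trans (fun i => lexx _) i0 ss.
  by move=> /(_ a b); rewrite !inE sn => /(_ (leq_ltn_trans ab bn) bn ab).
have sumE (h : 'I_n -> R) : \sum_i h i = \sum_(0 <= m < n) h (sg m).
  transitivity (\sum_(i <- s) h i); last by rewrite (big_nth i0) sn.
  by rewrite [RHS](perm_big (enum 'I_n)) ?perm_sort//= big_enum.
pose f := [ffun j : 'I_k.+1 => sg j].
pose g := [ffun j : 'I_k.+1 => if j == ord_max then sg k.+1 else sg j].
have fi : injective f.
  move=> a b; rewrite !ffunE => /sg_inj H; apply/val_inj/H;
    exact: ltn_trans (ltn_ord _) kn.
have gi : injective g.
  move=> a b; rewrite !ffunE.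
  have lt (c : 'I_k.+1) : (c < n)%N by exact: ltn_trans (ltn_ord _) kn.
  have ne (c : 'I_k.+1) : sg k.+1 <> sg c.
    by move=> /(sg_inj _ _ kn (lt c)) H; have := ltn_ord c; rewrite -H ltnn.
  have [->|_] := eqVneq a ord_max; have [->|_] := eqVneq b ord_max => //.
  - by move=> /ne.
  - by move=> /esym/ne.
  - by move=> /(sg_inj _ _ (lt a) (lt b)) /val_inj.
have fE : sumon f x = \sum_(0 <= m < k) Y m + Y k.
  rewrite /sumon big_ord_recr/= big_mkord ffunE; congr (_ + _).
  by apply: eq_bigr => j _; rewrite ffunE.
have gE : sumon g x = \sum_(0 <= m < k) Y m + Y k.+1.
  rewrite /sumon big_ord_recr/= big_mkord ffunE eqxx; congr (_ + _).
  apply: eq_bigr => j _; rewrite ffunE ifF//.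
  by apply/negbTE; rewrite -val_eqE/= ltn_eqF.
have gd : dotv d x <= sumon g x.
  have E1 : 1 <= \sum_(k.+1 <= m < n) e m.
    have -> : \sum_(k.+1 <= m < n) e m = \sum_(j < n - k.+1) e (j + k.+1)%N.
      by rewrite -{1}(add0n k.+1) big_addn big_mkord.
    apply: (dsum (fun j => sg (j + k.+1)%N)).
    move=> a b /sg_inj H; apply/val_inj/eqP; rewrite -(eqn_add2r k.+1); apply/eqP/H.
      by have := ltn_ord a; lia.
    by have := ltn_ord b; lia.
  have dE : \sum_(0 <= m < n) e m = k.+1%:R by rewrite -(sumE (fun i => d 0 i)).
  have kn' : (k <= n)%N by apply: ltnW; apply: ltnW.
  have split3 (h : nat -> R) : \sum_(0 <= m < n) h m =
      \sum_(0 <= m < k) h m + h k + \sum_(k.+1 <= m < n) h m.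
    by rewrite (big_cat_nat (n := k.+1))//= ?big_nat_recr//= ltnW.
  rewrite gE /dotv (sumE (fun i => d 0 i * x 0 i)) (split3 (fun m => e m * Y m)).
  rewrite split3 in dE.
  (* Termwise this is [0 <= (1 - e m) * (Y m - Y k)]. *)
  have S1 : \sum_(0 <= m < k) e m * Y m <=
      \sum_(0 <= m < k) Y m - k%:R * Y k + Y k * \sum_(0 <= m < k) e m.
    have -> : k%:R * Y k = \sum_(0 <= m < k) Y k by rewrite sumr_const_nat subn0 mulr_natl.
    rewrite mulr_sumr -sumrB -big_split/=; apply: ler_sum_nat => m /andP[_ mk].
    have := Ymono m k (ltnW mk) (ltnW kn); have := d1 (sg m); rewrite -/(e m); nra.
  have S3 : \sum_(k.+1 <= m < n) e m * Y m <= Y k.+1 * \sum_(k.+1 <= m < n) e m.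
    rewrite mulr_sumr; apply: ler_sum_nat => m /andP[km mn].
    by rewrite mulrC ler_wpM2r ?d0// Ymono.
  have bc := Ymono k k.+1 (leqnSn k) kn.
  move: E1 dE S1 S3; rewrite -natr1.
  set B := \sum_(_ <= m < _) e m; set A := \sum_(_ <= m < _) e m.
  move=> E1 dE S1 S3.
  (* As the weights sum to [k + 1], this product is what remains of [sumon g x - dotv d x] after the
     estimates [S1] and [S3]. *)
  have : 0 <= (Y k - Y k.+1) * (B - 1) by rewrite mulr_ge0// subr_ge0.
  have -> : B = k%:R + 1 - A - e k by rewrite -dE; ring.
  have {}S3 : \sum_(k.+1 <= m < n) e m * Y m <= Y k.+1 * (k%:R + 1 - A - e k).
    by apply: le_trans S3 _; rewrite (_ : k%:R + 1 - A - e k = B)// -dE; ring.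
  move: S1 S3; nra.
have gf : sumon g x <= sumon f x by rewrite fE gE lerD2l Ymono.
have /orP[f0|g0] : (minor F f != 0) || (minor F g != 0).
  apply: (exF f g ord_max fi gi).
    by move=> j jm; rewrite !ffunE (negbTE jm).
  rewrite !ffunE eqxx; apply/eqP => /(sg_inj _ _ (ltnW kn) kn)/eqP.
  by rewrite eqn_leq ltnn andbF.
- by exists f; [rewrite exprn_even_gt0|exact: le_trans gd gf].
- by exists g; [rewrite exprn_even_gt0|].
Qed.

(** * Chains of semistable segments *)

Lemma uniform_exists (R : realType) k n : exists F : 'M[R]_(k, n), uniform_mx F.
Proof.
exists (Vandermonde k (\row_j (j : nat)%:R)) => f fi.
rewrite /minor (_ : colsub f _ = Vandermonde k (\row_j (f j : nat)%:R)); last first.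
  by apply/matrixP => a b; rewrite !mxE.
rewrite det_Vandermonde; apply/prodf_neq0 => a _; apply/prodf_neq0 => b ab.
rewrite !mxE subr_eq0 eqr_nat; apply: contraTneq ab => /val_inj/fi ->.
by rewrite ltnn.
Qed.

(** Up to a power of [t], the minors are polynomials in [t^-1] whose value at 0 is a minor of [H];
    for small [t], the point [t^-1] lies beyond all their roots. *)
Lemma uniform_perturbation (R : realType) k n (F H : 'M[R]_(k, n)) : uniform_mx H ->
  exists2 eta, 0 < eta & forall t, 0 < t <= eta -> uniform_mx (F + t *: H).
Proof.
move=> uH.
pose q (f : {ffun 'I_k -> 'I_n}) : {poly R} :=
  \det ('X *: map_mx polyC (colsub f F) + map_mx polyC (colsub f H)).
have qE f s : (q f).[s] = \det (s *: colsub f F + colsub f H).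
  rewrite -horner_evalE -det_map_mx; congr (\det _).
  apply/matrixP => a b; rewrite !mxE. by rewrite /= horner_evalE !hornerE.
pose p := \prod_(f : {ffun 'I_k -> 'I_n} | injectiveb f) q f.
have p0 : p != 0.
  apply/prodf_neq0 => f /injectiveP fi; apply: contra_neq (uH f fi) => q0.
  by have := qE f 0; rewrite q0 horner0 scale0r add0r.
exists (cauchy_bound p)^-1.
  by rewrite invr_gt0 ltr_pwDl// mulr_ge0 ?invr_ge0// sumr_ge0.
move=> t /andP[t0 tp] f fi.
have : p.[t^-1] != 0.
  apply/eqP => /(cauchy_boundP p0); rewrite ltNge gtr0_norm ?invr_gt0//.
  by rewrite -[cauchy_bound p]invrK lef_pV2 ?posrE ?(lt_le_trans t0) ?tp.
rewrite /p horner_prod => /prodf_neq0/(_ f); rewrite qE => h.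
have -> : minor (F + t *: H) f = t ^+ k * \det (t^-1 *: colsub f F + colsub f H).
  rewrite -detZ; congr (\det _); apply/matrixP => a b; rewrite !mxE.
  by rewrite mulrDr mulrA divff ?mul1r// gt_eqF.
by apply: mulf_neq0; [rewrite expf_neq0 ?gt_eqF|exact/h/injectiveP].
Qed.

(** Chains of segments spare the concatenation of paths. *)
Inductive linked (R : realType) k n (d : 'rV[R]_n) : 'M[R]_(k, n) -> 'M[R]_(k, n) -> Prop :=
| linked_seg F G : (forall t : R, t \in `[0, 1] -> semistable_above d 0 (seg F G t)) ->
    linked d F G
| linked_sym F G : linked d F G -> linked d G F
| linked_trans F G H : linked d F G -> linked d G H -> linked d F H.

(** Each segment has its own range of small [e]; the filter intersects the finitely many ranges met
    along a chain. *)
Lemma linked_side (R : realType) k n (d : 'rV[R]_n) (side : R -> 'M[R]_(k, n) -> bool)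
    (F G : 'M[R]_(k, n)) :
  (forall F G, (forall t : R, t \in `[0, 1] -> semistable_above d 0 (seg F G t)) ->
    \forall e \near 0^'+, side e F = side e G) ->
  linked d F G -> \forall e \near 0^'+, side e F = side e G.
Proof.
move=> sideP; elim=> {F G} [F G|F G _|F G H _ FG _ GH].
- exact: sideP.
- by apply: filterS => e ->.
- by apply: filterS2 FG GH => e -> ->.
Qed.

Section Linking.
Context {R : realType} {n k : nat} (d : 'rV[R]_n).
Context (ex_ss : forall F : 'M[R]_(k, n), exchange_mx F -> semistable_above d 0 F).

(** Induction on the number [m] of leading columns where [F] and [G] may differ: the last of them is
    moved to a common generic [w] in both. *)
Lemma uniform_linked (F G : 'M[R]_(k, n)) : uniform_mx F -> uniform_mx G -> linked d F G.
Proof.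
move=> uF uG.
have [m FGm] : exists m, forall j : 'I_n, (m <= j)%N -> col j F = col j G.
  by exists n => j; rewrite leqNgt ltn_ord.
elim: m F G uF uG FGm => [|m IH] F G uF uG FGm.
  apply: linked_seg => t _; apply: ex_ss; apply: uniform_exchange.
  have -> : G = F by apply/matrixP => a b; have /colP/(_ a) := FGm b isT; rewrite !mxE.
  by rewrite /seg subrr scaler0 addr0.
have [nm|mn] := leqP n m.
  by apply: IH => // j; rewrite leqNgt (leq_trans (ltn_ord j)).
pose j := Ordinal mn; have [w [uFw uGw eF eG]] := generic_column j uF uG.
apply: (@linked_trans _ _ _ _ _ (setcol F j w)).
  by apply: linked_seg => t _; exact: ex_ss.
apply: (@linked_trans _ _ _ _ _ (setcol G j w)); last first.
  by apply/linked_sym/linked_seg => t _; exact: ex_ss.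
apply: IH => // l ml; apply/colP => a; rewrite !mxE.
have [//|lj] := eqVneq l j.
have ml' : (m < l)%N by rewrite ltn_neqAle ml andbT eq_sym.
by have /colP/(_ a) := FGm l ml'; rewrite !mxE.
Qed.

(** On the segment to a small uniform perturbation only the starting point may fail to be uniform,
    and it is semistable by assumption. *)
Lemma semistable_linked_uniform (F : 'M[R]_(k, n)) : semistable_above d 0 F ->
  exists2 G, uniform_mx G & linked d F G.
Proof.
move=> sF; have [H uH] := uniform_exists R k n.
have [eta eta0 uFH] := uniform_perturbation F uH.
exists (F + eta *: H); first by apply: uFH; rewrite eta0 lexx.
apply: linked_seg => t; rewrite in_itv/= => /andP[t0 t1].
have -> : seg F (F + eta *: H) t = F + (t * eta) *: H.
  by rewrite /seg [F + eta *: H]addrC addrK scalerA.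
have [->|t0'] := eqVneq t 0; first by rewrite mul0r scale0r addr0.
have {}t0 : 0 < t by rewrite lt_def t0'.
apply/ex_ss/uniform_exchange/uFH.
by rewrite mulr_gt0//= ler_piMl// ltW.
Qed.

End Linking.

(** * Connectedness of the fibre *)

Lemma schur_horn_fibre_closed (R : realType) n k (d : 'rV[R]_n) :
  closed (schur_horn_fibre k d).
Proof.
apply: closedI; first exact: grassmannian_closed.
have c : continuous (@schur_horn R n).
  move=> P; apply/(@cvg_mxP R _ _ (nbhs_filter P)) => i j; rewrite mxE.
  under eq_cvg do rewrite mxE.
  exact: coord_continuous.
apply: (continuous_closedP _).1 c _ _.
exact/accessible_closed_set1/hausdorff_accessible/norm_hausdorff.
Qed.

Theorem theorem1p1 (R : realType) (n k : nat) (hk : (1 <= k)%N)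
    (hkn : (k <= n)%N) (d : 'rV[R]_n) (hd : hypersimplex R n k d)
    (hsum : forall i : 'I_(n - k) -> 'I_n, injective i ->
       1 <= \sum_(j < n - k) d 0 (i j)) :
  connected (schur_horn_fibre k d).
Proof.
(* If [k = n], the empty sum would be at least 1. *)
have kn : (0 < k < n)%N.
  rewrite hk ltn_neqAle hkn andbT; apply/eqP => kn.
  have nk : (n - k = 0)%N by rewrite kn subnn.
  have inj : injective (fun j : 'I_(n - k) => widen_ord (leq_subr k n) j).
    by move=> a b /(congr1 val)/= ab; exact: val_inj.
  have := hsum _ inj.
  rewrite big1 => [|j _]; last by exfalso; have := ltn_ord j; rewrite [X in (_ < X)%N]nk.
  by rewrite ler10.
have ex_ss F := exchange_semistable kn hd hsum (F := F).
apply/connectedP => E [E0 EU [Es1 Es2]].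
(* The fibre being closed, its two separated pieces are closed in the whole matrix space. *)
have clE b : closed (E b).
  rewrite closure_id; apply/seteqP; split; first exact: subset_closure.
  move=> P cP; have : schur_horn_fibre k d P.
    apply: schur_horn_fibre_closed; apply: closureS cP; rewrite EU.
    by case: b => ? ?; [right|left].
  rewrite EU; case: b cP => cP [] // EP; exfalso.
    by have : (E false `&` closure (E true)) P by []; rewrite Es2.
  by have : (closure (E false) `&` E true) P by []; rewrite Es1.
have dE : E false `&` E true = set0 by apply: separated_disjoint.
(* A Urysohn function, 0 on [E false] and 1 on [E true]. *)
have [h [hc _ h0 h1]] := (uniform_separatorP (R := R) _ _).1
  ((normal_separatorP (R := R)).1 pseudometric_normal _ _ (clE false) (clE true) dE).
(* The part of the Grassmannian where [h] is 1/2 is compact and misses the fibre, so the squared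
   distance from its diagonals to [d] has a positive minimum. *)
have [eta eta0 hP] : exists2 eta : R, 0 < eta & forall P, grassmannian R n k P ->
    \sum_i (d 0 i - P i i) ^+ 2 < eta -> h P != 1 / 2.
  pose Z := grassmannian R n k `&` (h @^-1` [set 1 / 2]).
  have [Z0|Zn] := pselect (Z !=set0); last first.
    by exists 1 => // P GP _; apply/eqP => hP; apply: Zn; exists P.
  have Zc : compact Z.
    apply: subclosed_compact _ (@grassmannian_compact R n k) _ => [|P []//].
    apply: closedI; first exact: grassmannian_closed.
    by apply: (continuous_closedP _).1 hc _ _; exact: closed_eq.
  have [|P] := @compact_EVT_min _ _ (fun P : 'M[R]_n => \sum_i (d 0 i - P i i) ^+ 2) _ Z0 Zc.
    apply: continuous_subspaceT => P; apply: (@cvg_sumT _ _ _ _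
      (fun i (P : 'M[R]_n) => (d 0 i - P i i) ^+ 2) _ (nbhs_filter P)) => i.
    have cP : P' i i @[P' --> P] --> P i i by exact: coord_continuous.
    have dP : d 0 i - P' i i @[P' --> P] --> d 0 i - P i i by apply: cvgB cP; exact: cvg_cst.
    exact: (cvgM dP dP).
  rewrite inE => -[GP hPE] Pmin.
  exists (\sum_i (d 0 i - P i i) ^+ 2) => [|Q GQ]; last first.
    apply: contraTneq => hQ; rewrite -leNgt; apply: Pmin; rewrite inE; split => //.
  have s0 : 0 <= \sum_i (d 0 i - P i i) ^+ 2 by apply: sumr_ge0 => i _; exact: sqr_ge0.
  rewrite lt_def s0 andbT; apply/eqP => /eqP; rewrite psumr_eq0; last by move=> i _; exact: sqr_ge0.
  move=> /allP Pd.
  have : schur_horn_fibre k d P.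
    split => //; apply/rowP => i; rewrite mxE; apply/esym/eqP; rewrite -subr_eq0 -sqrf_eq0.
    exact: Pd (mem_index_enum i).
  rewrite EU => -[] EP.
    have := h0 (h P) (imageP _ EP); rewrite /= hPE; lra.
  have := h1 (h P) (imageP _ EP); rewrite /= hPE; lra.
have frame b : exists2 F : 'M[R]_(k, n), E b (rowproj F) &
    F *m F^T \in unitmx /\ schur_horn (rowproj F) = d.
  have [P EP] := E0 b.
  have [GP dP] : schur_horn_fibre k d P by rewrite EU; case: b EP; [right|left].
  by have [F Fu FP] := grassmannian_frame GP; exists F; rewrite FP.
have [F0 EF0 [F0u F0d]] := frame false; have [F1 EF1 [F1u F1d]] := frame true.
have [G0 uG0 lF0] := semistable_linked_uniform ex_ss (fibre_semistable F0u F0d).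
have [G1 uG1 lF1] := semistable_linked_uniform ex_ss (fibre_semistable F1u F1d).
have l01 := linked_trans (linked_trans lF0 (uniform_linked ex_ss uG0 uG1)) (linked_sym lF1).
have [e [e0]] : exists e : R, 0 < e /\
    (h (shadow d e F0) < 1 / 2) = (h (shadow d e F1) < 1 / 2).
  apply: (@filter_ex _ ((0 : R)^'+)); apply: filterI; first exact: nbhs_right_gt.
  apply: (linked_side (side := fun e F => h (shadow d e F) < 1 / 2)) l01 => F G.
  exact: shadow_same_side hc eta0 hP.
(* Both end shadows are the given points of the fibre, where [h] is 0 and 1, on different sides of
   1/2. *)
rewrite !shadow_fibre// (h0 _ (imageP _ EF0)) (h1 _ (imageP _ EF1)).
by rewrite divr_gt0// ltNge ler_pdivrMr// mul1r ler1n.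
Qed.
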